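(* Let $X$ be a $2\times 2$ real matrix, and let $G_X=\{e^{tX}:t\in\mathbb{R}\}$. Then $G_X$ is admissible if and only if $\operatorname{tr}(X)\neq 0$.
   Context: Let $G$ be a closed subgroup of $GL_n(\mathbb{R})$ (here $n=2$) with a left Haar measure $\mu$. Let $G_\#$ be the group of pairs $(a,b)\in G\times\mathbb{R}^n$ with multiplication $(\alpha,\beta)\cdot(a,b)=(\alpha a,\,b+a^{-1}\beta)$, with left Haar measure $d\lambda(a,b)=d\mu(a)\,db$. For $\psi\in L^2(\mathbb{R}^n)$ set $\psi_{(a,b)}(x)=|\det(a)|^{-1/2}\psi(a^{-1}x-b)$. A function $\psi\in L^2(\mathbb{R}^n)$ is called a continuous wavelet for $G$ if $f=\int_{G_\#}\langle f,\psi_{(a,b)}\rangle\psi_{(a,b)}\,d\lambda(a,b)$ for all $f\in L^2(\mathbb{R}^n)$. By a known result, this is equivalent to the condition $$\Delta_\psi(\xi):=\int_G|\hat\psi(a^T\xi)|^2\,d\mu(a)=1\quad\text{for almost every }\xi\in\mathbb{R}^n\setminus\{0\},$$ where $a^T$ is the transpose of $a$ and $\hat\psi$ is the Fourier transform of $\psi$ (normalized to be unitary on $L^2(\mathbb{R}^n)$). The group $G$ is called admissible if it admits a continuous wavelet, i.e. if there exists $\psi\in L^2(\mathbb{R}^n)$ satisfying $\Delta_\psi(\xi)=1$ for almost every $\xi\in\mathbb{R}^n\setminus\{0\}$. *)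

(* Defs.v *)
From HB Require Import structures.
From mathcomp Require Import all_boot all_order all_algebra.
From mathcomp Require Import all_classical all_reals all_analysis.
From mathcomp Require Import complex.

Set Implicit Arguments.
Unset Strict Implicit.
Unset Printing Implicit Defensive.

Import Order.TTheory GRing.Theory Num.Theory.
Import numFieldNormedType.Exports.

Local Open Scope classical_set_scope.
Local Open Scope ring_scope.
Local Open Scope complex_scope.

(* The plane is R * R, so that Lebesgue measure is the library's product
   measure. *)
Definition plane (R : realType) := (measurableTypeR R * measurableTypeR R)%type.

Definition leb2 (R : realType) : {measure set (plane R) -> \bar R} :=
  (@lebesgue_measure R \x @lebesgue_measure R)%E.

Definition dot2 (R : realType) (x y : plane R) : R := x.1 * y.1 + x.2 * y.2.

Definition mxact (R : realType) (a : 'M[R]_2) (x : plane R) : plane R :=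
  (a ord0 ord0 * x.1 + a ord0 ord_max * x.2,
   a ord_max ord0 * x.1 + a ord_max ord_max * x.2).

Definition cnorm (R : realType) (z : R[i]) : R := ComplexField.Normc.normc z.

Definition cmeasurable (R : realType) (f : plane R -> R[i]) : Prop :=
  measurable_fun setT (fun x => complex.Re (f x) : R) /\
  measurable_fun setT (fun x => complex.Im (f x) : R).

Definition L1 (R : realType) (f : plane R -> R[i]) : Prop :=
  cmeasurable f /\ (\int[leb2 R]_x (cnorm (f x))%:E < +oo)%E.

Definition L2 (R : realType) (f : plane R -> R[i]) : Prop :=
  cmeasurable f /\ (\int[leb2 R]_x (cnorm (f x) ^+ 2)%:E < +oo)%E.

Definition L2_cvg (R : realType) (f_ : nat -> plane R -> R[i])
    (f : plane R -> R[i]) : Prop :=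
  (\int[leb2 R]_x (cnorm (f_ k x - f x) ^+ 2)%:E)%E @[k --> \oo] --> 0%E.

Definition cintegral (R : realType) (f : plane R -> R[i]) : R[i] :=
  (\int[leb2 R]_x complex.Re (f x)) +i* (\int[leb2 R]_x complex.Im (f x)).

Definition expi (R : realType) (t : R) : R[i] := cos t +i* sin t.

(* The factor 2 pi in the exponent makes the transform unitary on L2. *)
Definition fourier_L1 (R : realType) (f : plane R -> R[i]) (xi : plane R)
    : R[i] :=
  cintegral (fun x => f x * expi (- (2 * pi * dot2 x xi))).

(* The Fourier transform on L2 is the extension by continuity of [fourier_L1]
   from L1 `&` L2; its graph is the L2-closure of that of [fourier_L1]. Since
   functions are not identified almost everywhere, this is a relation, saying
   that g represents the class of the transform of f. *)
Definition fourier_L2 (R : realType) (f g : plane R -> R[i]) : Prop :=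
  [/\ L2 f, L2 g &
    exists f_ : nat -> plane R -> R[i],
      [/\ forall k, L1 (f_ k) /\ L2 (f_ k),
          L2_cvg f_ f &
          L2_cvg (fun k => fourier_L1 (f_ k)) g]].

Definition borel_mx (R : realType) := g_sigma_algebraType (@open 'M[R]_2).

(* A Borel measure on a subgroup G of GL_2(R) is encoded as a Borel measure on
   'M[R]_2 that vanishes outside G. Finiteness on the compact subsets of G
   makes it a Radon measure on G when G is closed in GL_2(R), as G is then
   locally compact and second countable: regularity is automatic. *)
Definition left_haar (R : realType) (G : set 'M[R]_2)
    (mu : {measure set (borel_mx R) -> \bar R}) : Prop :=
  [/\ mu (~` G) = 0%E,
      mu G != 0%E,
      forall K : set 'M[R]_2, compact K -> K `<=` G -> (mu K < +oo)%E &
      forall (g : 'M[R]_2) (A : set 'M[R]_2), G g ->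
        measurable (A : set (borel_mx R)) -> A `<=` G ->
        mu [set g *m a | a in A] = mu A].

(* Delta_psi, as a function of psihat, a Fourier transform of psi *)
Definition Delta (R : realType) (G : set 'M[R]_2)
    (mu : {measure set (borel_mx R) -> \bar R}) (psihat : plane R -> R[i])
    (xi : plane R) : \bar R :=
  (\int[mu]_(a in (G : set (borel_mx R)))
     (cnorm (psihat (mxact (a : 'M[R]_2)^T xi)) ^+ 2)%:E)%E.

Definition admissible (R : realType) (G : set 'M[R]_2)
    (mu : {measure set (borel_mx R) -> \bar R}) : Prop :=
  exists psi psihat : plane R -> R[i],
    [/\ L2 psi, fourier_L2 psi psihat &
      \forall xi \ae leb2 R, xi != (0, 0) -> Delta G mu psihat xi = 1%E].

Definition expmx (R : realType) (A : 'M[R]_2) : 'M[R]_2 :=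
  limn (series (fun k : nat => (k`!%:R : R)^-1 *: A ^+ k)).

Definition one_param_group (R : realType) (X : 'M[R]_2) : set 'M[R]_2 :=
  [set expmx (t *: X) | t in [set: R]].

(* Main.v *)
(* Write E t = e^{tX}, so that det (E t) = e^{t tr X}, and let a act on the plane
   by x |-> a^T x.

   If tr X = 0 the action preserves area. Suppose that h = |psihat|^2 satisfies
   int h(a^T x) dmu(a) = 1 for almost every x. Multiplying k(x) = int h(a^-T x)
   dmu(a) by this identity at a good point x0 and translating in the group gives
   k = 1 almost everywhere too. As the dilation x |-> 2x commutes with the
   action, Tonelli yields
     int h = int int h(x) h(2 a^T x) = int int h(a^-T x) h(2x) = int h(2x)
           = (int h) / 4,
   hence h = 0 almost everywhere, a contradiction.

   If tr X > 0 (X and -X generate the same group), there is a nonzero quadratic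
   form Q with Q(E(t)^T x) = e^{t tr X} Q(x), so every orbit outside the null set
   Q = 0 spends exactly one unit of time in {1 <= |Q| < e^{tr X}}. This set has
   infinite area, but pulling its part in the annulus j <= |x|^2 < j + 1 back by
   time j, for each natural number j, shrinks the areas geometrically and leaves
   the hitting measure c = mu(E[0, 1)) unchanged. The resulting set S has finite
   area, and c^{-1/2} 1_S is the transform of a wavelet. That it is a transform
   is seen by damping the inverse transform of 1_S with e^{-e(|x1| + |x2|)}: the
   transform becomes the convolution of 1_S with a product of Cauchy kernels,
   which tends to 1_S in L2 because the boundary of S is negligible. *)

Require Import Defs.
From HB Require Import structures.
From mathcomp Require Import all_boot all_order all_algebra.
From mathcomp Require Import all_classical all_reals all_analysis.
From mathcomp Require Import measurable_realfun ring lra complex.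

Set Implicit Arguments.
Unset Strict Implicit.
Unset Printing Implicit Defensive.

Import Order.TTheory GRing.Theory Num.Theory.
Import numFieldNormedType.Exports.

Local Open Scope classical_set_scope.
Local Open Scope ring_scope.
Local Open Scope complex_scope.

(** With zero trace the orbits may be points, ellipses, lines or hyperbolas; comparison with a
    dilation treats them all at once, without a normal form of X. Only left invariance of [mu] is
    assumed, so k = 1 stands in for invariance under inversion.

    With positive trace the obstacle is [fourier_L2], which asks for approximants converging in L2
    on both sides. A single identity serves both. Let u be the convolution of 1_S with the kernel.
    Fubini gives: the integral of the damping times the squared modulus of the inverse transform of
    1_S equals the integral of 1_S u, hence is at most the area |S|. Removing the damping puts the
    inverse transform in L2. Moreover 0 <= u <= 1 gives int (u - 1_S)^2 <= 2 |S| - 2 int 1_S u, so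
    L2 convergence of the transforms needs only u -> 1 at interior points of S. Exponential damping
    is convenient because its transform is rational with an arctangent as primitive, so that the
    mass of the kernel near 0 is explicit. *)

Section sigma_finite_packing.
Context d (T : measurableType d) (R : realType).

(** The Fubini and Tonelli theorems read sigma-finiteness off the structure of the measure. Indexing
    an alias of [m] by the proof [h] attaches that structure to a measure whose sigma-finiteness is
    a proved fact. *)
Definition sigma_finite_pack (m : {measure set T -> \bar R})
  (h : sigma_finite setT m) : set T -> \bar R := m.

Variables (m : {measure set T -> \bar R}) (h : sigma_finite setT m).

HB.instance Definition _ := Measure.copy (sigma_finite_pack h) m.
HB.instance Definition _ :=
  Measure_isSigmaFinite.Build _ _ _ (sigma_finite_pack h) h.

End sigma_finite_packing.

(** * Linear changes of variables in the plane *)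

Section change_of_variables.
Local Open Scope ereal_scope.
Context {R : realType}.
Local Notation leb := (@lebesgue_measure R).
Local Notation RR := (measurableTypeR R).

Lemma sigma_finite_leb2 : sigma_finite setT (leb2 R).
Proof.
have /sigma_finiteP[F [TF ndF Foo]] := sigma_finiteT leb.
exists (fun n => F n `*` F n).
  rewrite -setXTT TF predeqE => -[x y]; split.
    move=> [/= [n _ Fnx] [k _ Gky]]; exists (maxn n k) => //; split.
    - by move: x Fnx; exact/subsetPset/ndF/leq_maxl.
    - by move: y Gky; exact/subsetPset/ndF/leq_maxr.
  by move=> [n _ []/= ? ?]; split; exists n.
move=> k; have [? ?] := Foo k.
split; first exact: measurableX.
rewrite [leb2 R _]product_measure1E// lte_mul_pinfty// ge0_fin_numE//.
Qed.

Definition lebp : {sigma_finite_measure set (plane R) -> \bar R} :=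
  sigma_finite_pack sigma_finite_leb2.

Lemma leb2_tonelli (f : plane R -> \bar R) : measurable_fun setT f -> (forall x, 0 <= f x) ->
  \int[leb2 R]_x f x = \int[leb]_x \int[leb]_y f (x, y).
Proof. by move=> mf f0; exact: (@fubini_tonelli1 _ _ _ _ R leb leb f mf f0). Qed.

Lemma leb2_tonelli_swap (f : plane R -> \bar R) : measurable_fun setT f -> (forall x, 0 <= f x) ->
  \int[leb2 R]_x f x = \int[leb]_y \int[leb]_x f (x, y).
Proof. by move=> mf f0; exact: (@fubini_tonelli2 _ _ _ _ R leb leb f mf f0). Qed.

Lemma measurable_affine (c d : R) :
  measurable_fun setT (fun x : RR => c * x + d : RR)%R.
Proof. by apply: measurable_funD => //; apply: measurable_funM. Qed.

(** Lebesgue measure is determined by half-open intervals, so it suffices to compare it there with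
    [|c|] times its image under the affine map. A negative [c] exchanges the open and the closed
    end, which leaves the length unchanged. *)
Lemma lebesgue_measure_affine (c d : R) (A : set RR) :
  c != 0%R -> measurable A ->
  leb ((fun x => c * x + d)%R @^-1` A) = `|c|^-1%:E * leb A.
Proof.
move=> c0 mA.
have c0' : (0 < `|c|)%R by rewrite normr_gt0.
pose f := fun x : RR => (c * x + d)%R : RR.
pose nu : {measure set RR -> \bar R} := mscale (NngNum (ltW c0'))
  (measure_function_pushforward__canonical__measure_function_Measure
    leb (measurable_affine c d)).
have H : forall B, ocitv B -> leb B = nu B.
  move=> _ [[a b] _ <-] /=.
  rewrite /nu /mscale /= /pushforward /=.
  have [c0''|c0''] := ltP 0%R c.
    rewrite (_ : f @^-1` _ = `]((a - d) / c)%R, ((b - d) / c)%R]%classic); last first.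
      apply/seteqP; split => x /=; rewrite /f !in_itv/=
      ltr_pdivrMr// ler_pdivlMr// ltrBlDr lerBrDr mulrC//.
    rewrite !lebesgue_measure_itv/= !lte_fin ltr_pM2r ?invr_gt0// ltrD2r.
    case: ifPn => _; last by rewrite mule0.
    by rewrite -!EFinB -EFinM gtr0_norm//; congr EFin; field; rewrite gt_eqF.
  have {}c0'' : (c < 0)%R by rewrite lt_neqAle c0.
  rewrite (_ : f @^-1` _ = `[((b - d) / c)%R, ((a - d) / c)%R[%classic); last first.
    apply/seteqP; split => x /=; rewrite /f !in_itv/=
      ltr_ndivlMr// ler_ndivrMr// ltrBlDr lerBrDr mulrC andbC//.
  rewrite !lebesgue_measure_itv/= !lte_fin ltr_nM2r ?invr_lt0// ltrD2r.
  case: ifPn => _; last by rewrite mule0.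
  by rewrite -!EFinB -EFinM ltr0_norm//; congr EFin; field; rewrite lt_eqF.
rewrite (lebesgue_measure_unique H mA) /nu /= /mscale /= muleA -EFinM mulVf ?gt_eqF//.
by rewrite mul1e.
Qed.

Lemma ge0_integral_affine (c d : R) (f : RR -> \bar R) : c != 0%R ->
  measurable_fun setT f -> (forall x, 0 <= f x) ->
  \int[leb]_x f (c * x + d)%R = `|c|^-1%:E * \int[leb]_x f x.
Proof.
move=> c0 mf f0.
have c0' : (0 <= `|c|^-1)%R by [].
have := @ge0_integral_pushforward _ _ _ _ R _ (measurable_affine c d) leb.
move=> /(_ setT f measurableT mf (fun x _ => f0 x)).
rewrite preimage_setT => <-.
rewrite -[X in X%:E * _]/((NngNum c0')%:num) -ge0_integral_mscale//.
apply: eq_measure_integral; first exact: measurable_affine.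
by move=> mg A mA _; exact: lebesgue_measure_affine.
Qed.

(** Phrased for nonnegative integrands, change of variables is stable under composition, and Tonelli
    reduces shears to translations of the line. For linear [phi], [k] is the absolute value of the
    determinant. *)
Definition scales_area (phi : plane R -> plane R) (k : R) :=
  measurable_fun setT phi /\
  forall f : plane R -> \bar R, measurable_fun setT f -> (forall x, 0 <= f x) ->
    \int[leb2 R]_x f (phi x) = (k^-1)%:E * \int[leb2 R]_x f x.

Lemma scales_area_comp phi psi k l : scales_area phi k -> scales_area psi l ->
  scales_area (phi \o psi) (k * l)%R.
Proof.
move=> [mphi hphi] [mpsi hpsi]; split; first exact: measurableT_comp.
move=> f mf f0.
have mfp : measurable_fun setT (f \o phi) by exact: measurableT_comp.
by rewrite [LHS](hpsi (f \o phi))//= hphi// muleA -EFinM invfM mulrC.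
Qed.

Lemma measurable_linear2 (a b c d : R) : measurable_fun setT
  (fun x : plane R => (a * x.1 + b * x.2, c * x.1 + d * x.2)%R : plane R).
Proof.
by apply/measurable_fun_pairP; split; apply: measurable_funD => //;
  apply: measurable_funM.
Qed.

(** On each horizontal line the shear is a translation. The factors 1 and 0 keep the map in the
    shape of [measurable_linear2]. *)
Lemma scales_area_upper (b : R) :
  scales_area (fun x => (1 * x.1 + b * x.2, 0 * x.1 + 1 * x.2)%R) 1%R.
Proof.
split; first exact: measurable_linear2.
move=> f mf f0.
rewrite invr1 mul1e !leb2_tonelli_swap//; last first.
  by apply: measurableT_comp => //; exact: measurable_linear2.
apply: eq_integral => y _ /=.
have mfy : measurable_fun setT (fun x : RR => f (x, y)) by exact: measurableT_comp.
have := @ge0_integral_affine 1 (b * y)%R _ (oner_neq0 R) mfy (fun=> f0 _).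
rewrite normr1 invr1 mul1e => <-.
by apply: eq_integral => x _; rewrite mul0r add0r !mul1r.
Qed.

Lemma scales_area_lower (b : R) :
  scales_area (fun x => (1 * x.1 + 0 * x.2, b * x.1 + 1 * x.2)%R) 1%R.
Proof.
split; first exact: measurable_linear2.
move=> f mf f0.
rewrite invr1 mul1e !leb2_tonelli//; last first.
  by apply: measurableT_comp => //; exact: measurable_linear2.
apply: eq_integral => x _ /=.
have mfx : measurable_fun setT (fun y : RR => f (x, y)) by exact: measurableT_comp.
have := @ge0_integral_affine 1 (b * x)%R _ (oner_neq0 R) mfx (fun=> f0 _).
rewrite normr1 invr1 mul1e => <-.
by apply: eq_integral => y _; rewrite mul0r addr0 !mul1r addrC.
Qed.

Lemma scales_area_diag (p q : R) : p != 0%R -> q != 0%R ->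
  scales_area (fun x => (p * x.1 + 0 * x.2, 0 * x.1 + q * x.2)%R) `|p * q|%R.
Proof.
move=> p0 q0; split; first exact: measurable_linear2.
move=> f mf f0.
rewrite !leb2_tonelli//; last first.
  by apply: measurableT_comp => //; exact: measurable_linear2.
transitivity (\int[leb]_x (`|q|^-1%:E * \int[leb]_y f (p * x + 0, y)%R)).
  apply: eq_integral => x _ /=.
  rewrite -(@ge0_integral_affine q 0)//; last by apply: (measurableT_comp mf).
  by apply: eq_integral => y _; rewrite !mul0r !addr0 add0r.
have mF : measurable_fun setT (fun x => \int[leb]_y f (x, y)).
  exact: (measurable_fun_fubini_tonelli_F (m2 := leb) f).
rewrite ge0_integralZl//; last 2 first.
- exact: (measurableT_comp mF (measurable_affine p 0)).
- by move=> x _; exact: integral_ge0.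
rewrite (@ge0_integral_affine p 0 (fun x => \int[leb]_y f (x, y)))//.
  by rewrite muleA -EFinM normrM invfM mulrC.
by move=> x; exact: integral_ge0.
Qed.

Lemma scales_area_linear (a b c d : R) : (a * d - b * c != 0)%R ->
  scales_area (fun x => (a * x.1 + b * x.2, c * x.1 + d * x.2)%R)
    `|a * d - b * c|%R.
Proof.
have main (a' b' c' d' : R) : (a' != 0)%R -> (a' * d' - b' * c' != 0)%R ->
  scales_area (fun x => (a' * x.1 + b' * x.2, c' * x.1 + d' * x.2)%R)
    `|a' * d' - b' * c'|%R.
  (* Factorization into lower shear, diagonal and upper shear. [q] is the Schur complement of the
     corner entry, so [a' * q] is the determinant. *)
  move=> a0 D0; pose q := (d' - b' * c' / a')%R.
  have q0 : (q != 0)%R.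
    apply: contra_neq D0 => q0; have E : (a' * d' - b' * c' = a' * q)%R.
      by rewrite /q; field.
    by rewrite E q0 mulr0.
  have := scales_area_comp (scales_area_comp (scales_area_lower (c' / a')%R)
    (scales_area_diag a0 q0)) (scales_area_upper (b' / a')%R).
  rewrite mulr1 mul1r (_ : a' * q = a' * d' - b' * c')%R; last by rewrite /q; field.
  congr scales_area; apply/funext => x /=.
  by congr pair; rewrite /q; field.
move=> D0; have [a0|a0] := eqVneq a 0%R; last exact: main.
(* With a zero corner, [c] cannot vanish: adding the second row to the first makes the corner
   nonzero, and a shear undoes this. *)
have c0 : (a + c != 0)%R.
  by rewrite a0 add0r; apply: contra_neq D0 => ->; rewrite a0; ring.
have D0' : ((a + c) * d - (b + d) * c != 0)%R.
  by rewrite (_ : (a + c) * d - (b + d) * c = a * d - b * c)%R//; ring.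
have := scales_area_comp (scales_area_upper (- 1)%R) (main _ _ _ _ c0 D0').
rewrite mul1r (_ : (a + c) * d - (b + d) * c = a * d - b * c)%R; last by ring.
congr scales_area; apply/funext => x /=.
by congr pair; ring.
Qed.

End change_of_variables.

(** * The matrix exponential *)

Lemma cvg_mx_entries (T : topologicalType) m n (U : Type) (F : set_system U)
    (f : U -> 'M[T]_(m, n)) (M : 'M[T]_(m, n)) : Filter F ->
  (forall i j, f x i j @[x --> F] --> M i j) -> f x @[x --> F] --> M.
Proof.
move=> FF fM A [P MP PA].
have : \forall x \near F, forall ij : 'I_m * 'I_n, P ij.1 ij.2 (f x ij.1 ij.2).
  by apply: filter_forall => -[i j]; exact: (fM i j _ (MP i j)).
by apply: filterS => x Px; apply: PA => i j; exact: (Px (i, j)).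
Qed.

Lemma sum2E (V : nmodType) (F : 'I_2 -> V) : \sum_i F i = F ord0 + F ord_max.
Proof.
by rewrite big_ord_recr/= big_ord_recr/= big_ord0 add0r;
  congr (F _ + F _); apply: val_inj.
Qed.

Lemma mxE2 (R : pzRingType) (A B : 'M[R]_2) i j :
  (A *m B) i j = A i ord0 * B ord0 j + A i ord_max * B ord_max j.
Proof. by rewrite mxE sum2E. Qed.

Lemma det2E (R : comNzRingType) (A : 'M[R]_2) :
  \det A = A ord0 ord0 * A ord_max ord_max - A ord0 ord_max * A ord_max ord0.
Proof.
rewrite (expand_det_row _ ord0) sum2E /cofactor !det_mx11 !mxE /=.
rewrite expr0 mul1r expr1 mulN1r mulrN.
by congr (_ * A _ _ - _ * A _ _); apply: val_inj.
Qed.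

Lemma tr2E (R : pzRingType) (A : 'M[R]_2) :
  \tr A = A ord0 ord0 + A ord_max ord_max.
Proof. by rewrite /mxtrace sum2E. Qed.

Section matrix_exponential.
Context {R : realType}.
Implicit Types (X : 'M[R]_2) (s t : R) (i j : 'I_2).

(** Coefficients in [t] of the entry [(i, j)] of [expmx (t *: X)]. Entry by entry, the exponential
    falls under the theory of real power series. *)
Let coef X i j k := (X ^+ k) i j / k`!%:R.

Lemma mxpow_entry_bound X i j k :
  `|(X ^+ k) i j| <= (\sum_i' \sum_j' `|X i' j'|) ^+ k.
Proof.
elim: k i j => [|k IH] i j.
  by rewrite !expr0 mxE; case: (i == j); rewrite /= ?normr1 ?normr0 ?ler01.
rewrite exprS -[_ * _]/(_ *m _) mxE.
rewrite (le_trans (ler_norm_sum _ _ _))// exprS.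
apply: (@le_trans _ _ (\sum_j' `|X i j'| * (\sum_i' \sum_j' `|X i' j'|) ^+ k)).
  by apply: ler_sum => l _; rewrite normrM ler_wpM2l.
rewrite -mulr_suml ler_wpM2r//.
  by rewrite exprn_ge0// sumr_ge0// => a _; rewrite sumr_ge0.
rewrite [leRHS](bigD1 i)//= lerDl sumr_ge0// => a _.
by rewrite sumr_ge0.
Qed.

Lemma is_cvg_expmx_coef X i j t : cvgn (pseries (coef X i j) t).
Proof.
apply: normed_cvg.
set M := \sum_i' \sum_j' `|X i' j'|.
have M0 : 0 <= M by rewrite sumr_ge0// => a _; rewrite sumr_ge0.
apply: (@series_le_cvg _ _ (exp_coeff (M * `|t|))) => [k|k|k|].
- exact: normr_ge0.
- by rewrite exp_coeff_ge0// mulr_ge0.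
- rewrite /= /exp_coeff/= /coef !normrM normfV normrX normr_nat exprMn mulrAC.
  by rewrite ler_wpM2r// ler_wpM2r ?exprn_ge0// mxpow_entry_bound.
- exact: is_cvg_series_exp_coeff.
Qed.

Lemma expmx_cvg X t :
  series (fun k : nat => (k`!%:R : R)^-1 *: (t *: X) ^+ k) @ \oo -->
  (\matrix_(i, j) limn (pseries (coef X i j) t) : 'M[R]_2).
Proof.
apply: cvg_mx_entries => i j; rewrite mxE.
rewrite (_ : (fun n => _) = pseries (coef X i j) t); first exact: is_cvg_expmx_coef.
apply/funext => n; rewrite /series/= summxE; apply: eq_bigr => k _.
by rewrite mxE exprZn mxE /coef mulrCA mulrC [X in X * _]mulrC.
Qed.

Lemma expmxE X t i j : expmx (t *: X) i j = limn (pseries (coef X i j) t).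
Proof.
by rewrite /expmx (cvg_lim _ (@expmx_cvg X t)) ?mxE//; exact: norm_hausdorff.
Qed.

Lemma expmx0 X : expmx (0 *: X) = 1%:M.
Proof.
apply/matrixP => i j; rewrite expmxE; apply: cvg_lim => //.
rewrite -(cvg_shiftS (pseries _ _)).
rewrite (_ : (fun n => _) = cst ((1%:M : 'M[R]_2) i j)); first exact: cvg_cst.
apply/funext => n; rewrite /pseries/= /series/= big_nat_recl//= big1 ?addr0.
  by rewrite /coef expr0 mulr1 fact0 divr1.
by move=> k _; rewrite expr0n/= mulr0.
Qed.

Lemma pseries_diffs_coef X i j k :
  pseries_diffs (coef X i j) k = (X ^+ k.+1) i j / k`!%:R.
Proof.
by rewrite /pseries_diffs /coef factS natrM invfM mulrCA mulVKf.
Qed.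

Lemma coef_shift X i j k : (X ^+ k.+1) i j / k`!%:R =
  X i ord0 * coef X ord0 j k + X i ord_max * coef X ord_max j k.
Proof. by rewrite exprS -[X * _]/(X *m _) mxE2 /coef; ring. Qed.

Lemma coef_shiftr X i j k : (X ^+ k.+1) i j / k`!%:R =
  X ord0 j * coef X i ord0 k + X ord_max j * coef X i ord_max k.
Proof. by rewrite exprSr -[_ * X]/(_ *m X) mxE2 /coef; ring. Qed.

(** Combined with [coef_shift], this both settles the convergence of the differentiated series and
    identifies their sums as entries of [X] times the exponential. *)
Lemma pseries_lin (a b c : R^nat) (x y t la lb : R) :
  (forall k, c k = x * a k + y * b k) ->
  pseries a t @ \oo --> la -> pseries b t @ \oo --> lb ->
  pseries c t @ \oo --> x * la + y * lb.
Proof.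
move=> cE ha hb.
rewrite (_ : pseries c t = (fun n => x * pseries a t n + y * pseries b t n)).
  by apply: cvgD; apply: cvgMr.
apply/funext => n; rewrite /pseries /series/= !mulr_sumr -big_split/=.
by apply: eq_bigr => k _; rewrite cE; ring.
Qed.

Lemma pseries_diffs_lin (a b c : R^nat) (x y : R) :
  (forall k, c k = x * a k + y * b k) ->
  forall k, pseries_diffs c k = x * pseries_diffs a k + y * pseries_diffs b k.
Proof. by move=> cE k; rewrite /pseries_diffs cE; ring. Qed.

Lemma is_derive_expmx X i j t :
  is_derive t 1 (fun t => expmx (t *: X) i j) ((X *m expmx (t *: X)) i j).
Proof.
have d1 i' j' k : pseries_diffs (coef X i' j') k =
    X i' ord0 * coef X ord0 j' k + X i' ord_max * coef X ord_max j' k.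
  by rewrite pseries_diffs_coef coef_shift.
have c1 i' j' u : cvgn (pseries (pseries_diffs (coef X i' j')) u).
  apply/cvg_ex; eexists.
  by apply: (pseries_lin (d1 i' j')); exact: is_cvg_expmx_coef.
have c2 i' j' u : cvgn (pseries (pseries_diffs (pseries_diffs (coef X i' j'))) u).
  apply/cvg_ex; eexists.
  by apply: (pseries_lin (pseries_diffs_lin (d1 i' j'))); exact: c1.
rewrite (_ : (fun t => _) = (fun t => limn (pseries (coef X i j) t))); last first.
  by apply/funext => u; rewrite expmxE.
have -> : (X *m expmx (t *: X)) i j = limn (pseries (pseries_diffs (coef X i j)) t).
  apply/esym/cvg_lim => //; rewrite mxE2 !expmxE.
  by apply: (pseries_lin (d1 i j)); exact: is_cvg_expmx_coef.
(* Termwise differentiation at [t] wants a point of larger modulus where the series and its first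
   two formal derivatives converge; they converge everywhere. *)
apply: (@pseries_snd_diffs _ _ (`|t| + 1)) => //.
  exact: is_cvg_expmx_coef.
by rewrite [X in _ < X]ger0_norm ?addr_ge0// ltrDl.
Qed.

(** A factor of [X ^+ k.+1] can be split off on either side, so both products are sums of the same
    differentiated series. *)
Lemma expmx_comm X t : X *m expmx (t *: X) = expmx (t *: X) *m X.
Proof.
apply/matrixP => i j; rewrite !mxE2 !expmxE.
have d1 k : pseries_diffs (coef X i j) k =
    X i ord0 * coef X ord0 j k + X i ord_max * coef X ord_max j k.
  by rewrite pseries_diffs_coef coef_shift.
have d2 k : pseries_diffs (coef X i j) k =
    X ord0 j * coef X i ord0 k + X ord_max j * coef X i ord_max k.
  by rewrite pseries_diffs_coef coef_shiftr.
have := pseries_lin d1 (@is_cvg_expmx_coef X _ _ t) (@is_cvg_expmx_coef X _ _ t).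
move=> /cvg_lim; move=> /(_ (@norm_hausdorff _ _)) <-.
apply: cvg_lim => //; rewrite ![_ * X _ _]mulrC.
by apply: (pseries_lin d2); exact: is_cvg_expmx_coef.
Qed.

Lemma continuous_expmx X : continuous (fun t => expmx (t *: X) : 'M[R]_2).
Proof.
move=> t; apply: cvg_mx_entries => i j.
have [d _] := @is_derive_expmx X i j t.
by move/derivable1_diffP/differentiable_continuous : d; exact.
Qed.

(** The left side has zero derivative in [t], hence equals its value at [t = 0]. The group law
    follows without multiplying series. *)
Lemma expmxDN X s t : expmx ((- t) *: X) *m expmx ((t + s) *: X) = expmx (s *: X).
Proof.
apply/matrixP => i j.
pose e i j (t : R) : R := expmx (t *: X) i j.
pose f u := e i ord0 (- u) * e ord0 j (u + s) + e i ord_max (- u) * e ord_max j (u + s).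
have -> : (expmx (- t *: X) *m expmx ((t + s) *: X)) i j = f t by rewrite mxE2.
have -> : expmx (s *: X) i j = f 0.
  by rewrite /f /e oppr0 add0r -mxE2 expmx0 mul1mx.
apply: is_derive_0_is_cst => u.
have de a b v : is_derive (v : R) (1 : R) (e a b)
    (X a ord0 * e ord0 b v + X a ord_max * e ord_max b v).
  by have := @is_derive_expmx X a b v; rewrite mxE2.
have deN a b v : is_derive (v : R) (1 : R) (fun v => e a b (- v))
    (- (e a ord0 (- v) * X ord0 b + e a ord_max (- v) * X ord_max b)).
  have h : is_derive (- v : R) (1 : R) (e a b)
    (e a ord0 (- v) * X ord0 b + e a ord_max (- v) * X ord_max b).
    by have := @is_derive_expmx X a b (- v); rewrite expmx_comm mxE2.
  have h2 : is_derive (v : R) (1 : R) (-%R : R -> R) (- 1) by exact: is_deriveNid.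
  by apply: (is_derive_eq (is_derive1_comp h h2)); rewrite mulrN1.
have deS a b v : is_derive (v : R) (1 : R) (fun v => e a b (v + s))
    (X a ord0 * e ord0 b (v + s) + X a ord_max * e ord_max b (v + s)).
  have h2 : is_derive (v : R) (1 : R) (fun v : R => v + s) 1.
    apply: (is_derive_eq (is_deriveD (is_derive_id v (1 : R)) (is_derive_cst s v (1 : R)))).
    by rewrite addr0.
  by apply: (is_derive_eq (@is_derive1_comp _ (e a b) (fun v : R => v + s)
    v _ _ (de a b (v + s)) h2)); rewrite mulr1.
apply: (is_derive_eq (is_deriveD (is_deriveM (deN i ord0 u) (deS ord0 j u))
  (is_deriveM (deN i ord_max u) (deS ord_max j u)))).
by rewrite /GRing.scale/=; ring.
Qed.

Lemma expmxD X s t : expmx ((s + t) *: X) = expmx (s *: X) *m expmx (t *: X).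
Proof.
have h : expmx (s *: X) *m expmx (- s *: X) = 1%:M.
  have := @expmxDN X 0 (- s); rewrite addr0 opprK => ->.
  by rewrite expmx0.
by rewrite -(@expmxDN X t s) mulmxA h mul1mx.
Qed.

Lemma expmxNV X t : expmx (- t *: X) *m expmx (t *: X) = 1%:M.
Proof. by have := @expmxDN X 0 t; rewrite addr0 => ->; rewrite expmx0. Qed.

(** Uniqueness for a linear scalar equation: [p u] times [expR (- k * u)] has zero derivative. *)
Lemma derive_expR_eq (p : R -> R) (k : R) :
  (forall t, is_derive (t : R) (1 : R) p (k * p t)) -> forall t, p t = expR (k * t) * p 0.
Proof.
move=> dp t.
pose f u := expR (- k * u) * p u.
have E u : is_derive (u : R) (1 : R) (fun u => expR (- k * u)) (- k * expR (- k * u)).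
  have h2 : is_derive (u : R) (1 : R) (fun u : R => - k * u) (- k).
    apply: (is_derive_eq (is_deriveZ (- k) (is_derive_id u (1 : R)))).
    by rewrite /GRing.scale/= mulr1.
  by apply: (is_derive_eq (@is_derive1_comp _ expR (fun u : R => - k * u)
    u _ _ (is_derive_expR (- k * u)) h2)); rewrite mulrC.
have fc : f t = f 0.
  apply: is_derive_0_is_cst => u; apply: (is_derive_eq (is_deriveM (E u) (dp u))).
  by rewrite /GRing.scale/=; ring.
move: fc; rewrite /f mulr0 expR0 mul1r => <-.
by rewrite mulrA -expRD mulNr addrN expR0 mul1r.
Qed.

(** Liouville's formula: the derivative of the expanded determinant is [\tr X] times the
    determinant. *)
Lemma det_expmx X t : \det (expmx (t *: X)) = expR (\tr X * t).
Proof.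
pose e i j (t : R) : R := expmx (t *: X) i j.
have de a b v : is_derive (v : R) (1 : R) (e a b)
    (X a ord0 * e ord0 b v + X a ord_max * e ord_max b v).
  by have := @is_derive_expmx X a b v; rewrite mxE2.
have dd u : is_derive (u : R) (1 : R) (fun t => \det (expmx (t *: X)))
    (\tr X * \det (expmx (u *: X))).
  rewrite (_ : (fun t => _) = fun t => e ord0 ord0 t * e ord_max ord_max t
    - e ord0 ord_max t * e ord_max ord0 t); last first.
    by apply/funext => v; rewrite det2E.
  apply: (is_derive_eq (is_deriveB
    (is_deriveM (de ord0 ord0 u) (de ord_max ord_max u))
    (is_deriveM (de ord0 ord_max u) (de ord_max ord0 u)))).
  by rewrite /GRing.scale/= det2E tr2E /e; ring.
by rewrite (derive_expR_eq dd) expmx0 det1 mulr1.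
Qed.

End matrix_exponential.

(** * Haar measure on a one-parameter group *)

Section borel_matrices.
Context {R : realType}.
Local Notation BM := (borel_mx R).

Lemma measurable_open_mx (A : set 'M[R]_2) : open A -> measurable (A : set BM).
Proof. exact: sub_sigma_algebra. Qed.

Lemma measurable_compact_mx (A : set 'M[R]_2) :
  compact A -> measurable (A : set BM).
Proof.
move=> /(compact_closed (@norm_hausdorff _ _))/closed_openC/measurable_open_mx.
by move=> /measurableC; rewrite setCK.
Qed.

Lemma measurable_mx_entry (i j : 'I_2) :
  measurable_fun setT (fun a : BM => (a : 'M[R]_2) i j : R).
Proof.
apply: (measurability _ (RGenOInfty.measurableE R)) => _ [_ [x ->] <-].
rewrite setTI; apply: measurable_open_mx.
have /continuousP := @coord_continuous R 2 2 i j; apply.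
exact: interval_open.
Qed.

Lemma measurable_mulmx (g : 'M[R]_2) :
  measurable_fun setT (fun a : BM => (g *m (a : 'M[R]_2)) : BM).
Proof.
apply: (@measurability _ _ BM BM setT _ (@open 'M[R]_2) erefl) => _ [A oA <-].
rewrite setTI.
apply: measurable_open_mx.
have /continuousP : continuous (fun a : 'M[R]_2 => g *m a); last exact.
move=> a.
apply: (@cvg_mx_entries _ _ _ _ _ (fun b : 'M[R]_2 => g *m b) _
  (nbhs_filter a)) => i j.
rewrite (_ : (fun b : 'M[R]_2 => (g *m b) i j) =
    (fun b => g i ord0 * b ord0 j + g i ord_max * b ord_max j)); last first.
  by apply/funext => b; rewrite mxE2.
rewrite mxE2; pose f k := (fun b : 'M[R]_2 => g i k * b k j).
apply: (@continuousD _ _ _ (f ord0) (f ord_max)); apply: continuousM;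
  [exact: cst_continuous|exact: coord_continuous|
   exact: cst_continuous|exact: coord_continuous].
Qed.

(** Matrix and point both depend on a parameter, so that one statement serves a fixed point as well
    as the pairs that occur under Tonelli. *)
Lemma measurable_mxact_tr (d : measure_display) (T : measurableType d)
    (a : T -> BM) (x : T -> plane R) :
  measurable_fun setT a -> measurable_fun setT x ->
  measurable_fun setT (fun u => mxact (a u : 'M[R]_2)^T (x u)).
Proof.
move=> ma mx.
have me i j : measurable_fun setT (fun u => (a u : 'M[R]_2)^T i j : R).
  rewrite (_ : (fun u => _) = (fun u => (a u : 'M[R]_2) j i)).
    exact: (measurableT_comp (measurable_mx_entry j i)).
  by apply/funext => u; rewrite mxE.
have m1 : measurable_fun setT (fun u => (x u).1 : R) by exact: measurableT_comp.
have m2 : measurable_fun setT (fun u => (x u).2 : R) by exact: measurableT_comp.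
by apply/measurable_fun_pairP; split; apply: measurable_funD;
  apply: measurable_funM.
Qed.

End borel_matrices.

Section haar.
Local Open Scope ereal_scope.
Context {R : realType} (X : 'M[R]_2) (mu : {measure set (borel_mx R) -> \bar R}).
Hypothesis hmu : left_haar (one_param_group X) mu.
Local Notation BM := (borel_mx R).
Local Notation G := (one_param_group X).
Local Notation E t := (expmx (t%R *: X)%R).

(** Arcs of the group. Time may be periodic, as for rotations, so arcs are handled through images,
    compactness and unions. *)
Definition time_set (I : set R) : set 'M[R]_2 := [set E t | t in I].

Lemma time_set_sub I : time_set I `<=` G.
Proof. by move=> _ [t _ <-]; exists t. Qed.

Lemma mem_one_param t : G (E t). Proof. by exists t. Qed.

Lemma compact_time_set a b : compact (time_set `[a, b]).
Proof.
rewrite /time_set; apply: continuous_compact; last exact: segment_compact.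
by apply: continuous_subspaceT; exact: continuous_expmx.
Qed.

(** Haar invariance speaks of images, whereas measurability and pushforwards speak of preimages;
    multiplying by the inverse converts one into the other. *)
Lemma mulmx_image s (A : set BM) :
  [set (E s *m (a : 'M[R]_2))%R | a in A] = (fun a : BM => E (- s) *m (a : 'M[R]_2))%R @^-1` A.
Proof.
apply/seteqP; split=> [_ [a Aa <-]|a /= Aa] /=.
  by rewrite mulmxA expmxNV mul1mx.
exists (E (- s) *m (a : 'M[R]_2))%R => //.
by rewrite mulmxA -{1}(opprK s) expmxNV mul1mx.
Qed.

Lemma time_set_translate s I :
  [set (E s *m a)%R | a in time_set I] = time_set [set (s + t)%R | t in I].
Proof.
apply/seteqP; split=> [_ [_ [t It <-] <-]|_ [_ [t It <-] <-]].
  by exists (s + t)%R; [exists t|rewrite expmxD].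
by exists (E t); [exists t|rewrite expmxD].
Qed.

Lemma haar_translate s (A : set BM) : measurable A -> A `<=` G ->
  mu [set (E s *m (a : 'M[R]_2))%R | a in A] = mu A.
Proof. by case: hmu => _ _ _ h mA AG; apply: h => //; exact: mem_one_param. Qed.

Lemma one_param_group_bigcup :
  G = \bigcup_n time_set `[(- n%:R)%R, n%:R].
Proof.
apply/seteqP; split=> [_ [t _ <-]|a [n _]]; last exact: time_set_sub.
have /ler_normlP[h1 h2] : (`|t| <= (Num.truncn `|t|).+1%:R)%R.
  by rewrite ltW// truncnS_gt.
exists (Num.truncn `|t|).+1 => //; exists t => //=.
by rewrite in_itv/= h2 lerNl h1.
Qed.

Lemma measurable_time_set a b : measurable (time_set `[a, b] : set BM).
Proof. by apply: measurable_compact_mx; exact: compact_time_set. Qed.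

Lemma measurable_one_param_group : measurable (G : set BM).
Proof.
rewrite one_param_group_bigcup; apply: bigcup_measurable => n _.
exact: measurable_time_set.
Qed.

Lemma haar_time_set_fin a b : mu (time_set `[a, b]) < +oo.
Proof.
by case: hmu => _ _ + _; apply; [exact: compact_time_set|exact: time_set_sub].
Qed.

Lemma haar_setC0 : mu (~` G) = 0. Proof. by case: hmu. Qed.

Lemma haar_sigma_finite : sigma_finite setT mu.
Proof.
(* [mu] lives on all matrices, so the null complement of the group is added to each compact arc to
   make the sets cover. *)
exists (fun n => ~` G `|` time_set `[(- n%:R)%R, n%:R]) => [|n].
  apply/seteqP; split=> // a _; have [Ga|nGa] := pselect (G a).
    by move: (Ga); rewrite {1}one_param_group_bigcup => -[n _ h]; exists n => //; right.
  by exists 0%N => //; left.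
have mC := measurableC measurable_one_param_group.
split; first exact: measurableU mC (measurable_time_set _ _).
rewrite (le_lt_trans (measureU2 _ mC (measurable_time_set _ _)))//.
by rewrite -[X in X + _]/(mu (~` G)) haar_setC0 add0e haar_time_set_fin.
Qed.

Lemma haar_setI (A : set BM) : measurable A -> mu A = mu (A `&` G).
Proof.
move=> mA; have mG := measurable_one_param_group.
have mC := measurableC mG.
rewrite -[in LHS](setIT A) -(setUv (G : set BM)) setIUr measureU; last 3 first.
- exact: measurableI.
- exact: measurableI.
- by rewrite setIACA setICr setI0.
rewrite [X in _ + X](_ : _ = 0) ?adde0//.
apply/eqP; rewrite -measure_le0 -haar_setC0.
by apply: le_measure; rewrite ?inE//; exact: measurableI.
Qed.

(** Invariance is given for subsets of the group; since the complement is null, both sides may first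
    be intersected with the group. *)
Lemma haar_preimage_translate s (A : set BM) : measurable A ->
  mu ((fun a : BM => (E s *m (a : 'M[R]_2))%R : BM) @^-1` A) = mu A.
Proof.
move=> mA; have mG := measurable_one_param_group.
have mP : measurable ((fun a : BM => (E s *m (a : 'M[R]_2))%R : BM) @^-1` A).
  by rewrite -[X in measurable X]setTI; exact: (measurable_mulmx (E s)).
rewrite haar_setI// [RHS]haar_setI//.
rewrite -(@haar_translate s _ (measurableI _ _ mP mG))//; congr (mu _).
rewrite mulmx_image; apply/seteqP; split=> a /=.
  move=> [+ [t _ Et]]; rewrite mulmxA -{1}(opprK s) expmxNV mul1mx => Aa.
  split=> //; exists (s + t)%R => //; rewrite expmxD Et mulmxA.
  by rewrite -{1}(opprK s) expmxNV mul1mx.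
move=> [Aa [t _ Et]]; rewrite mulmxA -{1}(opprK s) expmxNV mul1mx; split=> //.
by exists (- s + t)%R => //; rewrite expmxD Et.
Qed.

Lemma haar_integral_translate s (f : BM -> \bar R) :
  measurable_fun setT f -> (forall a, 0 <= f a) ->
  \int[mu]_a f (E s *m (a : 'M[R]_2))%R = \int[mu]_a f a.
Proof.
move=> mf f0.
have := @ge0_integral_pushforward _ _ _ _ R _ (measurable_mulmx (E s)) mu.
move=> /(_ setT f measurableT mf (fun x _ => f0 x)).
rewrite preimage_setT => <-.
apply: eq_measure_integral; first exact: measurable_mulmx.
by move=> mg A mA _; exact: haar_preimage_translate.
Qed.

(** This makes half-open arcs Borel. Unions pass through images even when time wraps around, whereas
    differences do not. *)
Lemma time_set_co_bigcup a b : (a < b)%R ->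
  time_set `[a, b[ = \bigcup_n time_set `[a, (b - n.+1%:R^-1)%R].
Proof.
move=> ab; apply/seteqP; split=> [_ [t /= + <-]|_ [n _ [t /= + <-]]].
  rewrite in_itv/= => /andP[at_ tb].
  exists (Num.truncn (b - t)^-1) => //; exists t => //=; rewrite in_itv/= at_/=.
  rewrite lerBrDr -lerBrDl -[leRHS]invrK lef_pV2 ?posrE ?invr_gt0 ?subr_gt0//.
  by rewrite ltW// truncnS_gt.
rewrite in_itv/= => /andP[at_ tb]; exists t => //=; rewrite in_itv/= at_/=.
by rewrite (le_lt_trans tb)// ltrBlDr ltrDl invr_gt0.
Qed.

Lemma measurable_time_set_co a b : measurable (time_set `[a, b[ : set BM).
Proof.
have [ab|ba] := ltP a b.
  rewrite time_set_co_bigcup//; apply: bigcup_measurable => n _.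
  exact: measurable_time_set.
rewrite (_ : time_set _ = set0)//.
by rewrite /time_set set_itv_ge ?image_set0// bnd_simp -leNgt.
Qed.

Lemma time_set_co_translate s : time_set `[s, (s + 1)%R[ =
  [set (E s *m a)%R | a in time_set `[0%R, 1%R[].
Proof.
rewrite time_set_translate; congr time_set; apply/seteqP; split=> [t|_ [t + <-]] /=.
  rewrite in_itv/= => /andP[st ts]; exists (t - s)%R; last by rewrite addrC subrK.
  by rewrite in_itv/= subr_ge0 st ltrBlDl.
by rewrite in_itv /= in_itv/= => /andP[t0 t1]; rewrite lerDl t0 ltrD2l.
Qed.

Lemma haar_time_set_co s : mu (time_set `[s, (s + 1)%R[) = mu (time_set `[0%R, 1%R[).
Proof.
rewrite time_set_co_translate; apply: haar_translate; last exact: time_set_sub.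
exact: measurable_time_set_co.
Qed.

Lemma haar_unit_fin : mu (time_set `[0%R, 1%R[) < +oo.
Proof.
rewrite (le_lt_trans _ (haar_time_set_fin 0%R 1%R))// le_measure ?inE//.
- exact: measurable_time_set_co.
- exact: measurable_time_set.
- by apply: image_subset => t /=; rewrite !in_itv/= => /andP[-> /ltW].
Qed.

(** Unit arcs are translates of each other, and countably many of them cover the group: if one were
    null, so would be the group. *)
Lemma haar_unit_gt0 : 0 < mu (time_set `[0%R, 1%R[).
Proof.
rewrite measure_gt0; apply/negP => /eqP m0.
have : mu.-negligible (G : set BM).
  have -> : (G : set BM) = \bigcup_n (time_set `[n%:R, (n%:R + 1)%R[ `|`
      time_set `[(- n%:R)%R, (- n%:R + 1)%R[).
    apply/seteqP; split=> [_ [t _ <-]|a [n _ [|]]]; last 2 first.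
    - exact: time_set_sub.
    - exact: time_set_sub.
    have [t0|t0] := leP 0%R t.
      exists (Num.truncn t) => //; left; exists t => //=.
      by rewrite in_itv/= truncn_le t0/= natr1 truncnS_gt.
    have h1 := truncnS_gt (- t); have h2 : ((Num.truncn (- t))%:R <= - t)%R.
      by rewrite truncn_le// oppr_ge0 ltW.
    move: h1; rewrite -natr1 => h1.
    (* For negative [t] the arc must start at minus the ceiling of [- t], which is the truncation
       exactly when [- t] is an integer. *)
    have [h3|h3] := eqVneq (- t)%R (Num.truncn (- t))%:R.
      exists (Num.truncn (- t)) => //; right; exists t => //=.
      by rewrite in_itv/= -h3 opprK lexx/= ltrDl.
    have {}h3 : ((Num.truncn (- t))%:R < - t)%R by rewrite lt_neqAle eq_sym h3.
    exists (Num.truncn (- t)).+1 => //; right; exists t => //=.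
    rewrite in_itv/= -natr1; lra.
  apply: negligible_bigcup => n; apply: negligibleU; apply/negligibleP.
  - exact: measurable_time_set_co.
  - exact: (etrans (haar_time_set_co _) m0).
  - exact: measurable_time_set_co.
  - exact: (etrans (haar_time_set_co _) m0).
move=> /(measure_negligible measurable_one_param_group) mG0.
by case: hmu => _; rewrite mG0 eqxx.
Qed.

End haar.

(** * The Cauchy kernel *)

Section one_dimensional_integrals.
Context {R : realType}.
Local Notation leb := (@lebesgue_measure R).
Local Notation RR := (measurableTypeR R).
Implicit Types (e z x : R).

Lemma is_derive_scale (c x : R) : is_derive x (1 : R) (fun u : R => c * u) c.
Proof.
apply: (is_derive_eq (is_deriveZ c (is_derive_id x (1 : R)))).
by rewrite /GRing.scale/= mulr1.
Qed.

Lemma is_derive_comp_scale (f : R -> R) (c x d : R) :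
  is_derive (c * x : R) (1 : R) f d ->
  is_derive x (1 : R) (fun u => f (c * u)) (c * d).
Proof.
move=> df.
apply: (is_derive_eq (@is_derive1_comp _ f (fun u : R => c * u) x _ _ df (is_derive_scale c x))).
by rewrite mulrC.
Qed.

Lemma is_derive_continuous (f df : R -> R) :
  (forall x, is_derive x (1 : R) f (df x)) -> continuous f.
Proof.
move=> d x; apply: differentiable_continuous; apply/derivable1_diffP.
by case: (d x).
Qed.

Lemma integral_0y_FTC (f F : R -> R) (l : R) :
  continuous f -> (forall x, 0 <= f x) ->
  (forall x, is_derive x (1 : R) F (f x)) -> F x @[x --> +oo] --> l ->
  (\int[leb]_(x in `[0%R, +oo[) (f x)%:E = (l - F 0)%:E)%E.
Proof.
move=> cf f0 dF Fl.
have cF := is_derive_continuous dF.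
rewrite (@ge0_continuous_FTC2y _ f F 0 l)//.
- exact: continuous_subspaceT.
- exact/cvg_at_right_filter/cF.
- by move=> x _; rewrite derive1E; case: (dF x).
Qed.

Lemma integral_even (f : R -> R) : continuous f -> (forall x, 0 <= f x) ->
  (forall x, f (- x) = f x) ->
  (\int[leb]_x (f x)%:E = 2%:E * \int[leb]_(x in `[0%R, +oo[) (f x)%:E)%E.
Proof.
move=> cf f0 fN; rewrite ge0_symfun_integralT//.
  by rewrite -set_itvcy.
by move=> x /=; rewrite fN.
Qed.

(** The summand 1 keeps the integrand nonnegative, so that the fundamental theorem applies on the
    half-line; [Rintegral_expabs_cos] subtracts it again. *)
Lemma expR_half_line (e z : R) : 0 < e ->
  (\int[leb]_(x in `[0%R, +oo[) (expR (- e * x) * (1 + cos (z * x)))%:E =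
  (e^-1 + e / (e ^+ 2 + z ^+ 2))%:E)%E.
Proof.
move=> e0; have ez0 : 0 < e ^+ 2 + z ^+ 2 by rewrite ltr_pwDl ?exprn_gt0 ?sqr_ge0.
(* The antiderivative that vanishes at infinity, so that the integral is [- F 0]. *)
pose F x := expR (- e * x) * (- e^-1 + (e ^+ 2 + z ^+ 2)^-1 *
   (- e * cos (z * x) + z * sin (z * x))).
pose f x := expR (- e * x) * (1 + cos (z * x)).
have cf : continuous f.
  have df x := (is_deriveM (is_derive_comp_scale (is_derive_expR (- e * x)))
    (is_deriveD (is_derive_cst (1 : R) (x : R) (1 : R))
      (is_derive_comp_scale (is_derive_cos (z * x))))).
  exact: (is_derive_continuous df).
have f0 x : 0 <= f x.
  by rewrite mulr_ge0 ?expR_ge0// -lerBlDl sub0r cos_geN1.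
have dF x : is_derive x (1 : R) F (f x).
  have dc := is_derive_comp_scale (is_derive_cos (z * x)).
  have ds := is_derive_comp_scale (is_derive_sin (z * x)).
  have de := is_derive_comp_scale (is_derive_expR (- e * x)).
  apply: (is_derive_eq (is_deriveM de (is_deriveD (is_derive_cst (- e^-1) x (1 : R))
    (is_deriveZ (e ^+ 2 + z ^+ 2)^-1 (is_deriveD (is_deriveZ (- e) dc)
      (is_deriveZ z ds)))))).
  (* With the exponential, the cosine and the sine abstracted, a rational identity remains. *)
  have alg (E c s : R) : E * (0 + (e ^+ 2 + z ^+ 2)^-1 *
     (- e * (z * - s) + z * (z * c))) +
     (- e^-1 + (e ^+ 2 + z ^+ 2)^-1 * (- e * c + z * s)) * (- e * E) = E * (1 + c).
    by field; rewrite !gt_eqF.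
  exact: alg.
have Fl : F x @[x --> +oo] --> 0.
  pose C := e^-1 + (e ^+ 2 + z ^+ 2)^-1 * (e + `|z|).
  have cC : expR (- e * x) * C @[x --> +oo] --> 0.
    rewrite -[X in _ --> X](mul0r C); apply: cvgMl.
    rewrite (_ : (fun x => expR (- e * x)) =
               (fun z => expR (- z)) \o (fun z => e * z)); last first.
      by apply: eq_fun => x; rewrite mulNr.
    apply: (@cvg_comp _ _ _ _ _ _ (pinfty_nbhs R)); last exact: cvgr_expR.
    exact: gt0_cvgMry.
  have FC x : `|F x| <= expR (- e * x) * C.
    rewrite /F normrM ger0_norm ?expR_ge0// ler_wpM2l ?expR_ge0//.
    rewrite (le_trans (ler_normD _ _))// normrN lerD//.
      by rewrite ger0_norm// invr_ge0 ltW.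
    rewrite normrM ger0_norm ?invr_ge0 ?(ltW ez0)// ler_wpM2l ?invr_ge0 ?(ltW ez0)//.
    rewrite (le_trans (ler_normD _ _))// !normrM normrN (gtr0_norm e0) lerD//.
      by rewrite ler_piMr ?(ltW e0)// cos_max.
    by rewrite ler_piMr// sin_max.
  apply: norm_cvg0; apply: (squeeze_cvgr _ (cvg_cst 0) cC).
  by apply: nearW => x; rewrite normr_ge0 FC.
rewrite (integral_0y_FTC cf f0 dF Fl).
rewrite /F !mulr0 expR0 cos0 sin0; congr EFin; field.
by rewrite !gt_eqF.
Qed.

Lemma continuous_scale_comp (f : R -> R) (c : R) :
  continuous f -> continuous (fun x => f (c * x)).
Proof.
move=> cf x; apply: (@continuous_comp _ _ _ (fun u : R => c * u) f); last exact: cf.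
by apply: continuousM; [exact: cst_continuous|].
Qed.

Definition expabs e x := expR (- e * `|x|).

Lemma continuous_expabs e : continuous (expabs e).
Proof.
move=> x; apply: (@continuous_comp _ _ _ (fun u : R => - e * `|u|) expR).
  apply: (@continuousM _ _ (cst (- e)) (fun u : R => `|u|)).
    exact: cst_continuous.
  exact: (@norm_continuous _ R).
exact: continuous_expR.
Qed.

Lemma expabs_ge0 e x : 0 <= expabs e x. Proof. exact: expR_ge0. Qed.

Lemma measurable_expabs e : measurable_fun setT (expabs e : RR -> R).
Proof. by apply: continuous_measurable_fun; exact: continuous_expabs. Qed.

Lemma expabs_line (e z : R) : 0 < e ->
  (\int[leb]_x (expabs e x * (1 + cos (z * x)))%:E =
  (2 * (e^-1 + e / (e ^+ 2 + z ^+ 2)))%:E)%E.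
Proof.
move=> e0; rewrite integral_even.
- rewrite EFinM -expR_half_line//; congr (_ * _)%E; apply: eq_integral => x.
  by rewrite inE/= in_itv/= andbT => x0; rewrite /expabs ger0_norm.
- move=> x; apply: (@continuousM _ _ (expabs e) (fun x => 1 + cos (z * x))).
    exact: continuous_expabs.
  apply: (@continuousD R R R (cst (1 : R)) (fun x : R => cos (z * x))).
    exact: cst_continuous.
  by apply: continuous_scale_comp; exact: continuous_cos.
- move=> x; apply: mulr_ge0; first exact: expabs_ge0.
  by have := cos_geN1 (z * x); lra.
- by move=> x; rewrite /expabs normrN mulrN cosN.
Qed.

Lemma integral_expabs e : 0 < e -> (\int[leb]_x (expabs e x)%:E = (2 / e)%:E)%E.
Proof.
move=> e0; have := @expabs_line e 0 e0.
rewrite (_ : 2 * _ = 2 * (2 / e)); last by field; rewrite gt_eqF.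
under eq_integral do rewrite mul0r cos0 mulrC EFinM.
rewrite ge0_integralZl//; last 2 first.
- by apply/measurable_EFinP; exact: measurable_expabs.
- by move=> x _; rewrite lee_fin expabs_ge0.
move=> /(congr1 (fun u => (2^-1)%:E * u)%E).
rewrite muleA -!EFinM (_ : 2^-1 * (1 + 1) = 1 :> R); last by field.
by rewrite mul1e => ->; congr EFin; field; rewrite gt_eqF.
Qed.

Lemma integrable_expabs e : 0 < e ->
  leb.-integrable setT (EFin \o (expabs e : RR -> R)).
Proof.
move=> e0; apply/integrableP; split.
  by apply/measurable_EFinP; exact: measurable_expabs.
under eq_integral do rewrite /= ger0_norm ?expabs_ge0//.
by rewrite integral_expabs// ltry.
Qed.

Lemma integrable_expabs_bounded e (b : RR -> R) : 0 < e ->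
  measurable_fun setT b -> (forall x, `|b x| <= 1) ->
  leb.-integrable setT (EFin \o (fun x => expabs e x * b x)).
Proof.
move=> e0 mb b1; apply: (le_integrable _ _ _ (integrable_expabs e0)) => //.
  by apply/measurable_EFinP/measurable_funM => //; exact: measurable_expabs.
move=> x _ /=; rewrite lee_fin normrM ler_piMr//.
Qed.

Lemma Rintegral_expabs_cos e z : 0 < e ->
  \int[leb]_x (expabs e x * cos (z * x)) = 2 * e / (e ^+ 2 + z ^+ 2).
Proof.
move=> e0.
have ic : leb.-integrable setT (EFin \o (fun x : RR => expabs e x * cos (z * x))).
  apply: integrable_expabs_bounded => //; last by move=> x; exact: cos_max.
  by apply: continuous_measurable_fun; apply: continuous_scale_comp; exact: continuous_cos.
have := RintegralD measurableT (integrable_expabs e0) ic.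
rewrite {1 2}/Rintegral integral_expabs//=.
under eq_integral do rewrite -[X in X + _]mulr1 -mulrDr.
by rewrite expabs_line//= mulrDr => /addrI <-; rewrite mulrA.
Qed.

Lemma Rintegral_expabs_sin e z : 0 < e ->
  \int[leb]_x (expabs e x * sin (z * x)) = 0.
Proof.
move=> e0.
have ms : measurable_fun setT (fun x : RR => sin (z * x)).
  by apply: continuous_measurable_fun; apply: continuous_scale_comp; exact: continuous_sin.
have is_ : leb.-integrable setT (EFin \o (fun x : RR => expabs e x * sin (z * x))).
  by apply: integrable_expabs_bounded => // x; exact: sin_max.
have := RintegralD measurableT (integrable_expabs e0) is_.
have := RintegralB measurableT (integrable_expabs e0) is_.
(* Reflection exchanges the two integrands, which are nonnegative because the sine is bounded by 1;
   their integrals also differ by twice the integral sought. *)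
have -> : \int[leb]_x (expabs e x - expabs e x * sin (z * x)) =
          \int[leb]_x (expabs e x + expabs e x * sin (z * x)).
  congr fine.
  have := @ge0_integral_affine R (-1) 0
    (fun x => (expabs e x + expabs e x * sin (z * x))%:E).
  rewrite normrN normr1 invr1 mul1e => <-//.
  - apply: eq_integral => x _.
    by rewrite mulN1r addr0 /expabs normrN mulrN sinN mulrN.
  - apply/measurable_EFinP; apply: measurable_funD; first exact: measurable_expabs.
    by apply: measurable_funM => //; exact: measurable_expabs.
  - move=> x; rewrite lee_fin -[X in X + _]mulr1 -mulrDr.
    apply: mulr_ge0; first exact: expabs_ge0.
    by have /ler_normlP[] := sin_max (z * x); lra.
move=> ->; lra.
Qed.

(** The Fourier transform of [expabs e]: the Cauchy density of scale [e / (2 * pi)]. *)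
Definition cauchy_kernel e z := 2 * e / (e ^+ 2 + (2 * pi * z) ^+ 2).

Lemma cauchy_den_gt0 e z : 0 < e -> 0 < e ^+ 2 + (2 * pi * z) ^+ 2.
Proof. by move=> e0; rewrite ltr_pwDl ?exprn_gt0 ?sqr_ge0. Qed.

Lemma cauchy_kernel_ge0 e z : 0 < e -> 0 <= cauchy_kernel e z.
Proof.
move=> e0; rewrite /cauchy_kernel divr_ge0 ?mulr_ge0 ?(ltW e0)//.
by rewrite (ltW (cauchy_den_gt0 _ _)).
Qed.

Lemma cauchy_kernelN e z : cauchy_kernel e (- z) = cauchy_kernel e z.
Proof. by rewrite /cauchy_kernel mulrN sqrrN. Qed.

Lemma is_derive_cauchy e x : 0 < e ->
  is_derive x (1 : R) (fun u => pi^-1 * atan (2 * pi / e * u)) (cauchy_kernel e x).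
Proof.
move=> e0; have pi0 := @pi_gt0 R.
have da := is_derive_comp_scale (is_derive1_atan (2 * pi / e * x)).
apply: (is_derive_eq (is_deriveZ (pi^-1) da)).
have D0 := cauchy_den_gt0 x e0.
rewrite -[_ *: _]/(_ * _) /cauchy_kernel.
have -> : 1 + (2 * pi / e * x) ^+ 2 = (e ^+ 2 + (2 * pi * x) ^+ 2) / e ^+ 2.
  by field; rewrite gt_eqF.
move: D0; set D := e ^+ 2 + (2 * pi * x) ^+ 2 => D0; clearbody D.
move: pi0; set p := pi; clearbody p => pi0.
by field; rewrite (gt_eqF D0) (gt_eqF e0) (gt_eqF pi0).
Qed.

Lemma continuous_cauchy e : 0 < e -> continuous (cauchy_kernel e).
Proof.
move=> e0 x; apply: (@continuousM _ _ (cst (2 * e))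
  (fun z => (e ^+ 2 + (2 * pi * z) ^+ 2)^-1)); first exact: cst_continuous.
apply: (@continuousV _ _ (fun z => e ^+ 2 + (2 * pi * z) ^+ 2)).
  by rewrite gt_eqF// cauchy_den_gt0.
apply: (@continuousD R R R (cst (e ^+ 2)) (fun z : R => (2 * pi * z) ^+ 2)).
  exact: cst_continuous.
exact/(@continuous_scale_comp (fun u => u ^+ 2))/exprn_continuous.
Qed.

Lemma measurable_cauchy e : 0 < e -> measurable_fun setT (cauchy_kernel e : RR -> R).
Proof. by move=> e0; apply: continuous_measurable_fun; exact: continuous_cauchy. Qed.

Lemma integral_cauchy e : 0 < e -> (\int[leb]_x (cauchy_kernel e x)%:E = 1)%E.
Proof.
move=> e0; have pi0 := @pi_gt0 R.
have dF x := is_derive_cauchy x e0.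
rewrite integral_even; last 3 first.
- exact: continuous_cauchy.
- by move=> x; exact: cauchy_kernel_ge0.
- by move=> x; exact: cauchy_kernelN.
rewrite (integral_0y_FTC (l := pi^-1 * (pi / 2)) _ _ dF).
- rewrite mulr0 atan0 mulr0 subr0 -EFinM; congr EFin.
  by rewrite [pi^-1 * _]mulrA mulVf ?gt_eqF// mul1r mulfV.
- exact: continuous_cauchy.
- by move=> x; exact: cauchy_kernel_ge0.
- apply: cvgMr; apply: (@cvg_comp _ _ _ _ _ _ (pinfty_nbhs R)); last exact: cvgy_atan.
  by apply: gt0_cvgMry; [rewrite divr_gt0// mulr_gt0|exact: cvg_id].
Qed.

(** For fixed [d] the right side tends to 1 as [e] tends to 0: the kernel concentrates at the
    origin. *)
Lemma integral_cauchy_segment e d : 0 < e -> 0 < d ->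
  (\int[leb]_x (\1_(`[- d, d]%classic) x * cauchy_kernel e x)%:E =
   (2 / pi * atan (2 * pi / e * d))%:E)%E.
Proof.
move=> e0 d0; have dF x := is_derive_cauchy x e0.
rewrite (_ : (\int[leb]_x _ = \int[leb]_(x in `[(- d)%R, d]) (cauchy_kernel e x)%:E)%E).
  rewrite (@continuous_FTC2 _ _ (fun u => pi^-1 * atan (2 * pi / e * u))).
  - by rewrite -EFinB mulrN atanN; congr EFin; ring.
  - by rewrite -subr_gt0 opprK addr_gt0.
  - exact/continuous_subspaceT/continuous_cauchy.
  - have cF := is_derive_continuous dF.
    split; first by move=> x _; case: (dF x).
    + exact/cvg_at_right_filter/cF.
    + exact/cvg_at_left_filter/cF.
  - by move=> x _; rewrite derive1E; case: (dF x).
rewrite [RHS]integral_mkcond; apply: eq_integral => x _.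
by rewrite patchE indicE; case: ifPn => _; rewrite ?mul1r ?mul0r.
Qed.

End one_dimensional_integrals.

(** * Fubini for dominated integrands *)

Section real_fubini.
Context d1 d2 (T1 : measurableType d1) (T2 : measurableType d2) (R : realType).
Context (m1 : {sigma_finite_measure set T1 -> \bar R})
        (m2 : {sigma_finite_measure set T2 -> \bar R}).

Lemma measurable_Rintegral (g : T1 * T2 -> R) : measurable_fun setT g ->
  measurable_fun setT (fun x => \int[m2]_y g (x, y)).
Proof.
move=> mg; rewrite /Rintegral; apply: (measurableT_comp (fine_measurable measurableT)).
under eq_fun do rewrite integralE.
have mg' : measurable_fun setT (EFin \o g) by exact/measurable_EFinP.
apply: emeasurable_funB.
- have h := @measurable_fun_fubini_tonelli_F _ _ T1 T2 R m2 ((EFin \o g)^\+)%E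
    (measurable_funepos mg') (fun=> funepos_ge0 _ _).
  apply: eq_measurable_fun h => x _; apply: eq_integral => y _.
  by rewrite !funeposE.
- have h := @measurable_fun_fubini_tonelli_F _ _ T1 T2 R m2 ((EFin \o g)^\-)%E
    (measurable_funeneg mg') (fun=> funeneg_ge0 _ _).
  apply: eq_measurable_fun h => x _; apply: eq_integral => y _.
  by rewrite !funenegE.
Qed.

Variables (f : T1 * T2 -> R) (g : T1 -> R) (h : T2 -> R).
Hypotheses (mf : measurable_fun setT f)
  (ig : m1.-integrable setT (EFin \o g)) (ih : m2.-integrable setT (EFin \o h))
  (g0 : forall x, 0 <= g x) (h0 : forall y, 0 <= h y)
  (fgh : forall x y, `|f (x, y)| <= g x * h y).

(** Domination by a product makes every section integrable, not merely almost every one, so [fine]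
    loses nothing on the inner integrals. *)
Lemma dominated_section1 x : m2.-integrable setT (EFin \o (fun y => f (x, y))).
Proof.
apply: (le_integrable _ _ _ (integrableZl measurableT (g x) ih)) => //.
  by apply/measurable_EFinP; exact: measurableT_comp.
by move=> y _ /=; rewrite lee_fin (le_trans (fgh x y))// ler_norm.
Qed.

Lemma dominated_section2 y : m1.-integrable setT (EFin \o (fun x => f (x, y))).
Proof.
apply: (le_integrable _ _ _ (integrableZl measurableT (h y) ig)) => //.
  by apply/measurable_EFinP; exact: measurableT_comp.
by move=> x _ /=; rewrite lee_fin (le_trans (fgh x y))// mulrC ler_norm.
Qed.

Lemma dominated_product : (m1 \x m2)%E.-integrable setT (EFin \o f).
Proof.
have mf' : measurable_fun setT (EFin \o f) by exact/measurable_EFinP.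
apply/(integrable12ltyP m1 m2 mf').
have mg : measurable_fun setT g by apply/measurable_EFinP; exact: measurable_int ig.
have mh : measurable_fun setT h by apply/measurable_EFinP; exact: measurable_int ih.
apply: (@le_lt_trans _ _ (\int[m1]_x ((g x)%:E * \int[m2]_y (h y)%:E))%E).
  apply: ge0_le_integral => //.
  - by move=> x _; exact: integral_ge0.
  - apply: (@measurable_fun_fubini_tonelli_F _ _ T1 T2 R m2 (fun z => `|(EFin \o f) z|)%E) => //.
    exact: measurableT_comp.
  - by apply: emeasurable_funM => //; exact/measurable_EFinP.
  - move=> x _; rewrite -ge0_integralZl//; last 3 first.
    + exact/measurable_EFinP.
    + by move=> y _; rewrite lee_fin.
    + by rewrite lee_fin.
    apply: ge0_le_integral => //.
    + by apply: measurableT_comp => //; apply/measurable_EFinP; exact: measurableT_comp.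
    + by apply: emeasurable_funM => //; exact/measurable_EFinP.
    + by move=> y _; rewrite /= -EFinM lee_fin.
have gf : (\int[m1]_x (g x)%:E < +oo)%E.
  have /integrableP[_] := ig; under eq_integral do rewrite /= ger0_norm//.
  by [].
have hf : (\int[m2]_x (h x)%:E < +oo)%E.
  have /integrableP[_] := ih; under eq_integral do rewrite /= ger0_norm//.
  by [].
rewrite ge0_integralZr//.
- by rewrite lte_mul_pinfty// ?integral_ge0// ?ge0_fin_numE// => *;
    rewrite ?integral_ge0// ?lee_fin => *; rewrite ?lee_fin.
- exact/measurable_EFinP.
- by move=> x _; rewrite lee_fin.
- by apply: integral_ge0 => y _; rewrite lee_fin.
Qed.

Lemma Rintegral_product :
  \int[(m1 \x m2)%E]_z f z = \int[m1]_x \int[m2]_y f (x, y).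
Proof.
rewrite /Rintegral; congr fine.
rewrite -(@integral12_prod_meas1 _ _ _ _ _ m1 m2 _ dominated_product).
apply: eq_integral => x _; rewrite fineK//.
exact: (integrable_fin_num measurableT (dominated_section1 x)).
Qed.

Lemma Rintegral_fubini :
  \int[m1]_x \int[m2]_y f (x, y) = \int[m2]_y \int[m1]_x f (x, y).
Proof.
rewrite -Rintegral_product /Rintegral; congr fine.
rewrite -(@integral21_prod_meas1 _ _ _ _ _ m1 m2 _ dominated_product).
apply: eq_integral => x _; rewrite fineK//.
exact: (integrable_fin_num measurableT (dominated_section2 x)).
Qed.

End real_fubini.

(** * Exponential damping in the plane and its Fourier transform *)

Section plane_kernels.
Context {R : realType}.
Local Notation leb := (@lebesgue_measure R).
Local Notation RR := (measurableTypeR R).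
Implicit Types (e : R).

Lemma leb2_tensor (p q : RR -> R) :
  measurable_fun setT p -> measurable_fun setT q ->
  (forall x, 0 <= p x) -> (forall x, 0 <= q x) ->
  (\int[leb2 R]_x (p x.1 * q x.2)%:E =
   \int[leb]_x (p x)%:E * \int[leb]_x (q x)%:E)%E.
Proof.
move=> mp mq p0 q0.
rewrite leb2_tonelli; last 2 first.
- apply/measurable_EFinP; apply: measurable_funM.
    exact: (measurableT_comp mp measurable_fst).
  exact: (measurableT_comp mq measurable_snd).
- by move=> x; rewrite lee_fin mulr_ge0.
rewrite -ge0_integralZr//; last 3 first.
- exact/measurable_EFinP.
- by move=> x _; rewrite lee_fin.
- by apply: integral_ge0 => x _; rewrite lee_fin.
apply: eq_integral => x _; rewrite -ge0_integralZl//.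
- exact/measurable_EFinP.
- by move=> y _; rewrite lee_fin.
- by rewrite lee_fin.
Qed.

Definition damping e (x : plane R) := expabs e x.1 * expabs e x.2.

Lemma damping_ge0 e x : 0 <= damping e x.
Proof. by rewrite mulr_ge0 ?expabs_ge0. Qed.

Lemma measurable_damping e : measurable_fun setT (damping e).
Proof.
apply: measurable_funM.
  exact: (measurableT_comp (measurable_expabs e) measurable_fst).
exact: (measurableT_comp (measurable_expabs e) measurable_snd).
Qed.

Lemma integrable_damping e : 0 < e ->
  (leb2 R).-integrable setT (EFin \o damping e).
Proof.
move=> e0; apply/integrableP; split.
  by apply/measurable_EFinP; exact: measurable_damping.
under eq_integral do rewrite /= ger0_norm ?damping_ge0//.
rewrite leb2_tensor ?integral_expabs//.
- by rewrite -EFinM ltry.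
- exact: measurable_expabs.
- exact: measurable_expabs.
- by move=> x; exact: expabs_ge0.
- by move=> x; exact: expabs_ge0.
Qed.

Definition phase (x z : plane R) := 2 * pi * dot2 x z.

Lemma measurable_phase : measurable_fun setT (fun u : plane R * plane R => phase u.1 u.2).
Proof.
apply: measurable_funM => //; apply: measurable_funD; apply: measurable_funM => //.
- exact: (measurableT_comp measurable_fst measurable_fst).
- exact: (measurableT_comp measurable_fst measurable_snd).
- exact: (measurableT_comp measurable_snd measurable_fst).
- exact: (measurableT_comp measurable_snd measurable_snd).
Qed.

Lemma measurable_phase1 z : measurable_fun setT (phase ^~ z).
Proof. exact: (measurableT_comp measurable_phase (measurable_pair2 z)). Qed.

Definition kernel2 e (z : plane R) := cauchy_kernel e z.1 * cauchy_kernel e z.2.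

Lemma kernel2_ge0 e z : 0 < e -> 0 <= kernel2 e z.
Proof. by move=> e0; apply: mulr_ge0; exact: cauchy_kernel_ge0. Qed.

Lemma phaseE x z : phase x z = 2 * pi * z.1 * x.1 + 2 * pi * z.2 * x.2.
Proof. by rewrite /phase /dot2; ring. Qed.

Lemma measurable_trig (f : R -> R) (c : R) : continuous f ->
  measurable_fun setT (fun u : RR => f (c * u) : R).
Proof.
by move=> cf; apply: continuous_measurable_fun; exact: continuous_scale_comp.
Qed.

Lemma measurable_damping_phase e (t : R -> R) z : continuous t ->
  measurable_fun setT (fun x => damping e x * t (phase x z)).
Proof.
move=> ct; apply: measurable_funM; first exact: measurable_damping.
apply: (measurableT_comp (continuous_measurable_fun ct)).
exact: measurable_phase1.
Qed.

(** The addition formula gives a product of cosines minus a product of sines, and the latter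
    integrates to 0 by parity. *)
Lemma Rintegral_damping_cos e z : 0 < e ->
  \int[leb2 R]_x (damping e x * cos (phase x z)) = kernel2 e z.
Proof.
move=> e0; pose f x := damping e x * cos (phase x z).
have mf : measurable_fun setT f.
  by apply: measurable_damping_phase; exact: continuous_cos.
have fb (x y : RR) : `|f (x, y)| <= expabs e x * expabs e y.
  rewrite normrM ger0_norm ?damping_ge0// ler_piMr ?damping_ge0//.
  exact: cos_max.
have ie := integrable_expabs e0.
rewrite [LHS](Rintegral_product mf ie ie (expabs_ge0 e) (expabs_ge0 e) fb).
have ic (c : R) : leb.-integrable setT (EFin \o (fun y : RR => expabs e y * cos (c * y))).
  apply: integrable_expabs_bounded => //; last by move=> ?; exact: cos_max.
  by apply: measurable_trig; exact: continuous_cos.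
have is_ (c : R) : leb.-integrable setT (EFin \o (fun y : RR => expabs e y * sin (c * y))).
  apply: integrable_expabs_bounded => //; last by move=> ?; exact: sin_max.
  by apply: measurable_trig; exact: continuous_sin.
transitivity (\int[leb]_x (expabs e x * cos (2 * pi * z.1 * x) * cauchy_kernel e z.2)).
  apply: eq_Rintegral => x _.
  transitivity (\int[leb]_y ((expabs e x * cos (2 * pi * z.1 * x)) *
       (expabs e y * cos (2 * pi * z.2 * y)) -
     (expabs e x * sin (2 * pi * z.1 * x)) * (expabs e y * sin (2 * pi * z.2 * y)))).
    by apply: eq_Rintegral => y _; rewrite /f /damping phaseE/= cosD; ring.
  rewrite RintegralB//; last 2 first.
  - exact: (integrableZl measurableT _ (ic (2 * pi * z.2))).
  - exact: (integrableZl measurableT _ (is_ (2 * pi * z.2))).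
  rewrite !RintegralZl// Rintegral_expabs_cos// Rintegral_expabs_sin//.
  by rewrite mulr0 subr0.
by rewrite RintegralZr// Rintegral_expabs_cos.
Qed.

Lemma Rintegral_damping_sin e z : 0 < e ->
  \int[leb2 R]_x (damping e x * sin (phase x z)) = 0.
Proof.
move=> e0; pose f x := damping e x * sin (phase x z).
have mf : measurable_fun setT f.
  by apply: measurable_damping_phase; exact: continuous_sin.
have fb (x y : RR) : `|f (x, y)| <= expabs e x * expabs e y.
  rewrite normrM ger0_norm ?damping_ge0// ler_piMr ?damping_ge0//.
  exact: sin_max.
have ie := integrable_expabs e0.
rewrite [LHS](Rintegral_product mf ie ie (expabs_ge0 e) (expabs_ge0 e) fb).
have ic (c : R) : leb.-integrable setT (EFin \o (fun y : RR => expabs e y * cos (c * y))).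
  apply: integrable_expabs_bounded => //; last by move=> ?; exact: cos_max.
  by apply: measurable_trig; exact: continuous_cos.
have is_ (c : R) : leb.-integrable setT (EFin \o (fun y : RR => expabs e y * sin (c * y))).
  apply: integrable_expabs_bounded => //; last by move=> ?; exact: sin_max.
  by apply: measurable_trig; exact: continuous_sin.
transitivity (\int[leb]_x (expabs e x * sin (2 * pi * z.1 * x) * cauchy_kernel e z.2)).
  apply: eq_Rintegral => x _.
  transitivity (\int[leb]_y ((expabs e x * sin (2 * pi * z.1 * x)) *
       (expabs e y * cos (2 * pi * z.2 * y)) +
     (expabs e x * cos (2 * pi * z.1 * x)) * (expabs e y * sin (2 * pi * z.2 * y)))).
    by apply: eq_Rintegral => y _; rewrite /f /damping phaseE/= sinD; ring.
  rewrite RintegralD//; last 2 first.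
  - exact: (integrableZl measurableT _ (ic (2 * pi * z.2))).
  - exact: (integrableZl measurableT _ (is_ (2 * pi * z.2))).
  rewrite !RintegralZl// Rintegral_expabs_cos// Rintegral_expabs_sin//.
  by rewrite mulr0 addr0.
by rewrite RintegralZr// Rintegral_expabs_sin// mul0r.
Qed.

Lemma shifted_tensor (p q : RR -> R) (a : plane R) :
  measurable_fun setT p -> measurable_fun setT q ->
  (forall x, 0 <= p x) -> (forall x, 0 <= q x) ->
  (\int[leb2 R]_x (p (x.1 - a.1) * q (x.2 - a.2))%:E =
   \int[leb]_x (p x)%:E * \int[leb]_x (q x)%:E)%E.
Proof.
move=> mp mq p0 q0.
have sh (f : RR -> R) (c : R) : measurable_fun setT f -> (forall x, 0 <= f x) ->
    (\int[leb]_x (f (x - c))%:E = \int[leb]_x (f x)%:E)%E.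
  move=> mf f0.
  have := @ge0_integral_affine R 1 (- c) (fun x => (f x)%:E) (oner_neq0 R).
  rewrite normr1 invr1 mul1e => <-.
  - by under [RHS]eq_integral do rewrite mul1r.
  - exact/measurable_EFinP.
  - by move=> x; rewrite lee_fin.
have msh (f : RR -> R) (c : R) : measurable_fun setT f ->
    measurable_fun setT (fun x : RR => f (x - c)).
  by move=> mf; apply: (measurableT_comp mf); exact: measurable_funB.
rewrite -(sh p a.1)// -(sh q a.2)//.
by rewrite (@leb2_tensor (fun x => p (x - a.1)) (fun x => q (x - a.2)))//; exact: msh.
Qed.

Lemma integral_kernel2 e (a : plane R) : 0 < e ->
  (\int[leb2 R]_x (kernel2 e (x.1 - a.1, x.2 - a.2)%R)%:E = 1)%E.
Proof.
move=> e0; rewrite [LHS](@shifted_tensor (cauchy_kernel e) (cauchy_kernel e) a).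
- by rewrite !integral_cauchy// mule1.
- exact: measurable_cauchy.
- exact: measurable_cauchy.
- by move=> x; exact: cauchy_kernel_ge0.
- by move=> x; exact: cauchy_kernel_ge0.
Qed.

End plane_kernels.

Section plane_fubini.
Context {R : realType}.
Variables (f : plane R * plane R -> R) (g h : plane R -> R).
Hypotheses (mf : measurable_fun setT f)
  (ig : (leb2 R).-integrable setT (EFin \o g))
  (ih : (leb2 R).-integrable setT (EFin \o h))
  (g0 : forall x, 0 <= g x) (h0 : forall y, 0 <= h y)
  (fgh : forall x y, `|f (x, y)| <= g x * h y).

Lemma plane_fubini : \int[leb2 R]_x \int[leb2 R]_y f (x, y) =
  \int[leb2 R]_y \int[leb2 R]_x f (x, y).
Proof. exact: (@Rintegral_fubini _ _ _ _ R lebp lebp f g h). Qed.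

Lemma plane_measurable_Rintegral :
  measurable_fun setT (fun x => \int[leb2 R]_y f (x, y)).
Proof. exact: (@measurable_Rintegral _ _ _ _ R lebp f mf). Qed.

End plane_fubini.

Lemma plane_tonelli {R : realType} (f : plane R * plane R -> \bar R) :
  measurable_fun setT f -> (forall x, 0 <= f x)%E ->
  (\int[leb2 R]_x \int[leb2 R]_y f (x, y) =
   \int[leb2 R]_y \int[leb2 R]_x f (x, y))%E.
Proof. by move=> mf f0; exact: (@fubini_tonelli _ _ _ _ R lebp lebp f mf f0). Qed.

Section complex_norm.
Context {R : realType}.
Implicit Types a b : R.

Lemma cnorm_sqr a b : cnorm (a +i* b) ^+ 2 = a ^+ 2 + b ^+ 2.
Proof.
by rewrite /cnorm /ComplexField.Normc.normc sqr_sqrtr// addr_ge0 ?sqr_ge0.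
Qed.

Lemma cnorm_ge0 (z : R[i]) : 0 <= cnorm z.
Proof. by case: z => a b; exact: sqrtr_ge0. Qed.

Lemma cnorm_le a b : cnorm (a +i* b) <= `|a| + `|b|.
Proof.
rewrite -(@ler_pXn2r _ 2)// ?nnegrE ?cnorm_ge0 ?addr_ge0//.
rewrite cnorm_sqr sqrrD !real_normK ?num_real//.
by rewrite lerD2r lerDl mulrn_wge0// mulr_ge0.
Qed.

End complex_norm.

Lemma cvg_scale_nat (R : realType) (c : R) : 0 < c ->
  c * n.+1%:R @[n --> \oo] --> +oo.
Proof.
move=> c0.
have n_y : (n.+1%:R : R) @[n --> \oo] --> +oo.
  by have := @cvgr_idn R; rewrite -(cvg_shiftS (fun n => n%:R : R)); exact.
apply/cvgryPge => b.
move/cvgryPge: n_y => /(_ (b / c)); apply: filterS => n.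
by rewrite ler_pdivrMr// mulrC.
Qed.

(** * The Fourier transform of an indicator function *)

Section fourier_indicator.
Context {R : realType}.
(* O plays the role of the interior of S. *)
Variables (S O : set (plane R)).
Implicit Types e : R.
Hypotheses (mS : measurable S) (finS : (leb2 R S < +oo)%E)
  (nullSO : (leb2 R).-negligible (S `\` O))
  (intO : forall z, O z -> exists2 d, 0 < d &
     forall y, `|y.1 - z.1| <= d -> `|y.2 - z.2| <= d -> S y).

Let s : plane R -> R := \1_S.
Let M := fine (leb2 R S).
(** [A] and [B] are the real and imaginary parts of the inverse Fourier transform of the indicator;
    kept apart, they leave only real integrals. *)
Let A x := \int[leb2 R]_y (s y * cos (phase x y)).
Let B x := \int[leb2 R]_y (s y * sin (phase x y)).
Let sub (y z : plane R) : plane R := (y.1 - z.1, y.2 - z.2).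

Let ME : M%:E = leb2 R S.
Proof. by rewrite /M fineK// ge0_fin_numE. Qed.

Let s0 x : 0 <= s x. Proof. by rewrite /s indicE. Qed.

Let s1 x : s x <= 1. Proof. by rewrite /s indicE lern1 leq_b1. Qed.

Let ms : measurable_fun setT s. Proof. exact: measurable_indic. Qed.

Let int_s : (\int[leb2 R]_x (s x)%:E = M%:E)%E.
Proof. by rewrite ME /s integral_indic// setIT. Qed.

Let is_ : (leb2 R).-integrable setT (EFin \o s).
Proof.
apply/integrableP; split; first exact/measurable_EFinP.
by under eq_integral do rewrite /= ger0_norm//; rewrite int_s ltry.
Qed.

Let integrable_s_bounded (b : plane R -> R) (c : R) : measurable_fun setT b ->
  (forall x, `|b x| <= c) -> (leb2 R).-integrable setT (EFin \o (fun x => s x * b x)).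
Proof.
move=> mb bc; apply: (le_integrable _ _ _ (integrableZl measurableT c is_)) => //.
  by apply/measurable_EFinP; exact: measurable_funM.
move=> x _ /=; rewrite lee_fin normrM (ger0_norm (s0 x)) mulrC.
by rewrite (le_trans _ (ler_norm _))// ler_wpM2r.
Qed.

Let measurable_phase2 (x : plane R) (t : R -> R) : continuous t ->
  measurable_fun setT (fun y => t (phase x y)).
Proof.
move=> ct; apply: (measurableT_comp (continuous_measurable_fun ct)).
exact: (measurableT_comp measurable_phase (measurable_pair1 x)).
Qed.

Let integrable_s_trig x (t : R -> R) : continuous t -> (forall u, `|t u| <= 1) ->
  (leb2 R).-integrable setT (EFin \o (fun y => s y * t (phase x y))).
Proof.
by move=> ct t1; apply: (@integrable_s_bounded _ 1) => //; exact: measurable_phase2.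
Qed.

Let trig_bound (t : R -> R) x : continuous t -> (forall u, `|t u| <= 1) ->
  `|\int[leb2 R]_y (s y * t (phase x y))| <= M.
Proof.
move=> ct t1; have it := integrable_s_trig x ct t1.
rewrite (le_trans (le_normr_Rintegral _ it))//.
rewrite (_ : M = \int[leb2 R]_y s y); last by rewrite /Rintegral int_s.
apply: le_Rintegral => //.
  by have := integrable_norm it; apply: eq_integrable => // y _; rewrite /=.
by move=> y _; rewrite normrM (ger0_norm (s0 y)) ler_piMr.
Qed.

Let A_le x : `|A x| <= M.
Proof. by apply: trig_bound; [exact: continuous_cos|exact: cos_max]. Qed.

Let B_le x : `|B x| <= M.
Proof. by apply: trig_bound; [exact: continuous_sin|exact: sin_max]. Qed.

Let M0 : 0 <= M. Proof. exact: le_trans (A_le (0, 0)). Qed.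

Let measurable_trig_transform (t : R -> R) : continuous t ->
  measurable_fun setT (fun x => \int[leb2 R]_y (s y * t (phase x y))).
Proof.
move=> ct.
apply: (@plane_measurable_Rintegral _ (fun u => s u.2 * t (phase u.1 u.2))).
apply: measurable_funM; first exact: (measurableT_comp ms measurable_snd).
apply: (measurableT_comp (continuous_measurable_fun ct)); exact: measurable_phase.
Qed.

Let mA : measurable_fun setT A.
Proof. by apply: measurable_trig_transform; exact: continuous_cos. Qed.

Let mB : measurable_fun setT B.
Proof. by apply: measurable_trig_transform; exact: continuous_sin. Qed.

Let phase_sub x y z : phase x (sub y z) = phase x y - phase x z.
Proof. by rewrite /phase /dot2/=; ring. Qed.

(** Real part of the inverse transform times the conjugate character at [z]; this product amounts to
    translating the indicator. [AB_sin] is the imaginary part. *)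
Let AB_cos x z : A x * cos (phase x z) + B x * sin (phase x z) =
  \int[leb2 R]_y (s y * cos (phase x (sub y z))).
Proof.
have ic := integrable_s_trig x (@continuous_cos R) (@cos_max R).
have isn := integrable_s_trig x (@continuous_sin R) (@sin_max R).
rewrite /A /B -!RintegralZr// -RintegralD//.
- by apply: eq_Rintegral => y _; rewrite phase_sub cosB; ring.
- by have := integrableZr measurableT (cos (phase x z)) ic.
- by have := integrableZr measurableT (sin (phase x z)) isn.
Qed.

Let AB_sin x z : B x * cos (phase x z) - A x * sin (phase x z) =
  \int[leb2 R]_y (s y * sin (phase x (sub y z))).
Proof.
have ic := integrable_s_trig x (@continuous_cos R) (@cos_max R).
have isn := integrable_s_trig x (@continuous_sin R) (@sin_max R).
rewrite /A /B -!RintegralZr// -RintegralB//.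
- by apply: eq_Rintegral => y _; rewrite phase_sub sinB; ring.
- by have := integrableZr measurableT (cos (phase x z)) isn.
- by have := integrableZr measurableT (sin (phase x z)) ic.
Qed.

(** The convolution of the indicator with the even kernel [kernel2 e]; by [fourier_re] and
    [fourier_im] it is the transform of the damped inverse transform. *)
Let u e z := \int[leb2 R]_y (s y * kernel2 e (sub y z)).

Let measurable_sub1 z : measurable_fun setT (sub ^~ z).
Proof.
by apply/measurable_fun_pairP; split; apply: measurable_funB => //.
Qed.

Let fourier_exchange e z (t : R -> R) : 0 < e ->
  continuous t -> (forall v, `|t v| <= 1) ->
  \int[leb2 R]_x (damping e x * \int[leb2 R]_y (s y * t (phase x (sub y z)))) =
  \int[leb2 R]_y (s y * \int[leb2 R]_x (damping e x * t (phase x (sub y z)))).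
Proof.
move=> e0 ct t1.
pose F (v : plane R * plane R) := damping e v.1 * (s v.2 * t (phase v.1 (sub v.2 z))).
have mF : measurable_fun setT F.
  apply: measurable_funM; first exact: (measurableT_comp (measurable_damping e) measurable_fst).
  apply: measurable_funM; first exact: (measurableT_comp ms measurable_snd).
  apply: (measurableT_comp (continuous_measurable_fun ct)).
  have mv : measurable_fun setT
      (fun v : plane R * plane R => (v.1, sub v.2 z)).
    apply/measurable_fun_pairP; split; first exact: measurable_fst.
    exact: (measurableT_comp (measurable_sub1 z) measurable_snd).
  exact: (measurableT_comp measurable_phase mv).
have Fb x y : `|F (x, y)| <= damping e x * s y.
  rewrite /F /= normrM (ger0_norm (damping_ge0 _ _)) normrM (ger0_norm (s0 y)).
  by rewrite mulrA ler_piMr// mulr_ge0// damping_ge0.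
transitivity (\int[leb2 R]_x \int[leb2 R]_y F (x, y)).
  apply: eq_Rintegral => x _; rewrite /F /= RintegralZl//.
  apply: (@integrable_s_bounded _ 1) => //.
  apply: (measurableT_comp (continuous_measurable_fun ct)).
  have mv : measurable_fun setT (fun y : plane R => (x, sub y z)).
    apply/measurable_fun_pairP; split; first exact: measurable_cst.
    exact: (measurable_sub1 z).
  exact: (measurableT_comp measurable_phase mv).
rewrite (plane_fubini mF (integrable_damping e0) is_ (damping_ge0 e) s0 Fb).
apply: eq_Rintegral => y _; rewrite -RintegralZl//.
  by apply: eq_Rintegral => x _; rewrite /F /=; ring.
apply: (le_integrable _ _ _ (integrable_damping e0)) => //.
  by apply/measurable_EFinP; exact: measurable_damping_phase.
move=> x _ /=; rewrite lee_fin normrM ler_piMr//.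
Qed.

Let fourier_re e z : 0 < e ->
  \int[leb2 R]_x (damping e x * (A x * cos (phase x z) + B x * sin (phase x z))) = u e z.
Proof.
move=> e0; under eq_Rintegral do rewrite AB_cos.
rewrite fourier_exchange//; [|exact: continuous_cos|exact: cos_max].
by apply: eq_Rintegral => y _; rewrite Rintegral_damping_cos.
Qed.

Let fourier_im e z : 0 < e ->
  \int[leb2 R]_x (damping e x * (B x * cos (phase x z) - A x * sin (phase x z))) = 0.
Proof.
move=> e0; under eq_Rintegral do rewrite AB_sin.
rewrite fourier_exchange//; [|exact: continuous_sin|exact: sin_max].
under eq_Rintegral do rewrite Rintegral_damping_sin// mulr0.
by rewrite /Rintegral integral0.
Qed.

Let measurable_kernel2 e : 0 < e -> measurable_fun setT (kernel2 e).
Proof.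
move=> e0; apply: measurable_funM.
  exact: (measurableT_comp (measurable_cauchy e0) measurable_fst).
exact: (measurableT_comp (measurable_cauchy e0) measurable_snd).
Qed.

Let measurable_sK e : 0 < e -> measurable_fun setT
  (fun v : plane R * plane R => s v.2 * kernel2 e (sub v.2 v.1)).
Proof.
move=> e0; apply: measurable_funM.
  exact: (measurableT_comp ms measurable_snd).
have mv : measurable_fun setT (fun v : plane R * plane R => sub v.2 v.1).
  apply/measurable_fun_pairP; split; apply: measurable_funB.
  - exact: (measurableT_comp measurable_fst measurable_snd).
  - exact: (measurableT_comp measurable_fst measurable_fst).
  - exact: (measurableT_comp measurable_snd measurable_snd).
  - exact: (measurableT_comp measurable_snd measurable_fst).
exact: (measurableT_comp (measurable_kernel2 e0) mv).
Qed.

Let sK_ge0 e y z : 0 < e -> 0 <= s y * kernel2 e (sub y z).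
Proof. by move=> e0; rewrite mulr_ge0// kernel2_ge0. Qed.

Let integral_sK_le1 e z : 0 < e ->
  (\int[leb2 R]_y (s y * kernel2 e (sub y z))%:E <= 1)%E.
Proof.
move=> e0; rewrite -(integral_kernel2 z e0); apply: ge0_le_integral => //.
- by move=> y _; rewrite lee_fin sK_ge0.
- apply/measurable_EFinP.
  exact: (measurableT_comp (measurable_sK e0) (measurable_pair1 z)).
- apply/measurable_EFinP.
  exact: (measurableT_comp (measurable_kernel2 e0) (measurable_sub1 z)).
- by move=> y _; rewrite lee_fin ler_piMl// kernel2_ge0.
Qed.

Let uE e z : 0 < e ->
  ((u e z)%:E = \int[leb2 R]_y (s y * kernel2 e (sub y z))%:E)%E.
Proof.
move=> e0; rewrite /u /Rintegral fineK// ge0_fin_numE.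
  by rewrite (le_lt_trans (integral_sK_le1 _ e0))// ltry.
by apply: integral_ge0 => y _; rewrite lee_fin sK_ge0.
Qed.

Let u_ge0 e z : 0 < e -> 0 <= u e z.
Proof.
move=> e0; rewrite -lee_fin uE//; apply: integral_ge0 => y _.
by rewrite lee_fin sK_ge0.
Qed.

Let u_le1 e z : 0 < e -> u e z <= 1.
Proof. by move=> e0; rewrite -lee_fin uE// integral_sK_le1. Qed.

Let mu_ e : 0 < e -> measurable_fun setT (u e).
Proof.
by move=> e0; exact: (plane_measurable_Rintegral (measurable_sK e0)).
Qed.

Let integral_u e : 0 < e -> (\int[leb2 R]_z (u e z)%:E = M%:E)%E.
Proof.
move=> e0; under eq_integral do rewrite uE//.
rewrite (plane_tonelli
  (f := fun v => (s v.2 * kernel2 e (sub v.2 v.1))%:E)); last 2 first.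
- by apply/measurable_EFinP; exact: measurable_sK.
- by move=> v; rewrite lee_fin sK_ge0.
rewrite -int_s; apply: eq_integral => y _ /=.
transitivity (\int[leb2 R]_z ((s y)%:E * (kernel2 e (sub z y))%:E))%E.
  apply: eq_integral => z _; rewrite -EFinM; congr (_ * _)%:E.
  by rewrite /kernel2 /= -cauchy_kernelN -[X in _ * X]cauchy_kernelN !opprB.
rewrite ge0_integralZl//; last 3 first.
- apply/measurable_EFinP.
  exact: (measurableT_comp (measurable_kernel2 e0) (measurable_sub1 y)).
- by move=> z _; rewrite lee_fin kernel2_ge0.
- by rewrite lee_fin.
by rewrite [X in (_ * X)%E](integral_kernel2 y e0) mule1.
Qed.

Let integrable_u e : 0 < e -> (leb2 R).-integrable setT (EFin \o u e).
Proof.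
move=> e0; apply/integrableP; split; first by apply/measurable_EFinP; exact: mu_.
under eq_integral do rewrite /= ger0_norm ?u_ge0//.
by rewrite integral_u// ltry.
Qed.

(** Overlap of the indicator with its smoothing. It is the damped energy in [energy] and controls
    the L2 distance in [target_cvg]. *)
Let v e := \int[leb2 R]_z (s z * u e z).

Let integrable_su e : 0 < e ->
  (leb2 R).-integrable setT (EFin \o (fun z => s z * u e z)).
Proof.
move=> e0; apply: (@integrable_s_bounded _ 1); first exact: mu_.
by move=> z; rewrite ger0_norm ?u_ge0// u_le1.
Qed.

Let vE e : 0 < e -> ((v e)%:E = \int[leb2 R]_z (s z * u e z)%:E)%E.
Proof.
move=> e0; rewrite /v /Rintegral fineK//.
exact: (integrable_fin_num measurableT (integrable_su e0)).
Qed.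

Let v_le e : 0 < e -> v e <= M.
Proof.
move=> e0; rewrite -lee_fin vE// -int_s; apply: ge0_le_integral => //.
- by move=> z _; rewrite lee_fin mulr_ge0// u_ge0.
- by apply/measurable_EFinP; apply: measurable_funM => //; exact: mu_.
- exact/measurable_EFinP.
- by move=> z _; rewrite lee_fin ler_piMr// u_le1.
Qed.

Let w x := A x ^+ 2 + B x ^+ 2.

Let w_ge0 x : 0 <= w x. Proof. by rewrite addr_ge0 ?sqr_ge0. Qed.

Let mw : measurable_fun setT w.
Proof. by apply: measurable_funD; exact: measurable_funX. Qed.

Let w_le x : w x <= 2 * M ^+ 2.
Proof.
rewrite mulr_natl mulr2n lerD// -[leLHS]ger0_norm ?sqr_ge0// normrX.
  by rewrite lerXn2r ?nnegrE.
by rewrite lerXn2r ?nnegrE.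
Qed.

Let integrable_dw e : 0 < e ->
  (leb2 R).-integrable setT (EFin \o (fun x => damping e x * w x)).
Proof.
move=> e0.
apply: (le_integrable _ _ _
  (integrableZl measurableT (2 * M ^+ 2) (integrable_damping e0))) => //.
  apply/measurable_EFinP; apply: measurable_funM => //; exact: measurable_damping.
move=> x _ /=.
have h1 : 0 <= damping e x * w x by apply: mulr_ge0; first exact: damping_ge0.
rewrite lee_fin (ger0_norm h1); apply: le_trans (ler_norm _).
by rewrite mulrC ler_wpM2r// damping_ge0.
Qed.

(** A damped Parseval identity. Integrating [F] first in its second variable produces [w];
    integrating first in the other produces [u e], by [fourier_re]. *)
Let energy e : 0 < e ->
  (\int[leb2 R]_x (damping e x * w x)%:E = (v e)%:E)%E.
Proof.
move=> e0.
suff E : \int[leb2 R]_x (damping e x * w x) = v e.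
  by rewrite -E /Rintegral fineK//;
    exact: (integrable_fin_num measurableT (integrable_dw e0)).
pose F (p : plane R * plane R) := damping e p.1 *
  (s p.2 * (A p.1 * cos (phase p.1 p.2) + B p.1 * sin (phase p.1 p.2))).
have mAc x : measurable_fun setT (fun z => A x * cos (phase x z) + B x * sin (phase x z)).
  apply: measurable_funD; apply: measurable_funM => //; apply: measurable_phase2.
    exact: continuous_cos.
  exact: continuous_sin.
have mF : measurable_fun setT F.
  apply: measurable_funM; first exact: (measurableT_comp (measurable_damping e) measurable_fst).
  apply: measurable_funM; first exact: (measurableT_comp ms measurable_snd).
  apply: measurable_funD; apply: measurable_funM.
  - exact: (measurableT_comp mA measurable_fst).
  - apply: (measurableT_comp (continuous_measurable_fun (@continuous_cos R))).
    exact: measurable_phase.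
  - exact: (measurableT_comp mB measurable_fst).
  - apply: (measurableT_comp (continuous_measurable_fun (@continuous_sin R))).
    exact: measurable_phase.
have ABb x z : `|A x * cos (phase x z) + B x * sin (phase x z)| <= 2 * M.
  rewrite (le_trans (ler_normD _ _))// mulr_natl mulr2n.
  by rewrite lerD// normrM -[leRHS]mulr1 ler_pM// ?cos_max ?sin_max.
pose g x := damping e x * (2 * M).
have ig : (leb2 R).-integrable setT (EFin \o g).
  by have := integrableZr measurableT (2 * M) (integrable_damping e0).
have g0 x : 0 <= g x.
  by apply: mulr_ge0; [exact: damping_ge0|exact: mulr_ge0].
have Fb x y : `|F (x, y)| <= g x * s y.
  rewrite /F /= normrM (ger0_norm (damping_ge0 _ _)) normrM (ger0_norm (s0 y)).
  by rewrite /g -mulrA ler_wpM2l ?damping_ge0// mulrC ler_wpM2r.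
have := plane_fubini mF ig is_ g0 s0 Fb.
rewrite (_ : \int[leb2 R]_x _ = \int[leb2 R]_x (damping e x * w x)); last first.
  apply: eq_Rintegral => x _.
  rewrite /F /= RintegralZl//; last exact: (integrable_s_bounded (mAc x) (ABb x)).
  congr (_ * _).
  transitivity (\int[leb2 R]_y (A x * (s y * cos (phase x y)) + B x * (s y * sin (phase x y)))).
    by apply: eq_Rintegral => y _; ring.
  have ic := integrable_s_trig x (@continuous_cos R) (@cos_max R).
  have isn := integrable_s_trig x (@continuous_sin R) (@sin_max R).
  rewrite RintegralD//; last 2 first.
  - by have := integrableZl measurableT (A x) ic.
  - by have := integrableZl measurableT (B x) isn.
  by rewrite !RintegralZl// /w !expr2.
move=> ->; apply: eq_Rintegral => z _.
rewrite -(fourier_re z e0) -RintegralZl//.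
  by apply: eq_Rintegral => x _; rewrite /F /=; ring.
apply: (le_integrable _ _ _ ig) => //.
  apply/measurable_EFinP; apply: measurable_funM; first exact: measurable_damping.
  apply: measurable_funD; apply: measurable_funM => //.
    apply: (measurableT_comp (continuous_measurable_fun (@continuous_cos R))).
    exact: measurable_phase1.
  apply: (measurableT_comp (continuous_measurable_fun (@continuous_sin R))).
  exact: measurable_phase1.
move=> x _ /=; rewrite lee_fin normrM (ger0_norm (damping_ge0 _ _)).
by rewrite (ger0_norm (g0 x)) /g ler_wpM2l ?damping_ge0.
Qed.

Let en (n : nat) : R := n.+1%:R^-1.

Let en0 n : 0 < en n. Proof. by rewrite invr_gt0. Qed.

Let dampingE e x : damping e x = expR (- e * (`|x.1| + `|x.2|)).
Proof. by rewrite /damping /expabs -expRD mulrDr. Qed.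

Let damping_le1 e x : 0 < e -> damping e x <= 1.
Proof.
move=> e0; rewrite dampingE -expR0 ler_expR mulNr oppr_le0.
by rewrite mulr_ge0 ?(ltW e0)// addr_ge0.
Qed.

Let damping_nd x : {homo (fun n => damping (en n) x) : n m / (n <= m)%N >-> n <= m}.
Proof.
move=> n m nm; rewrite !dampingE ler_expR !mulNr lerN2 ler_wpM2r ?addr_ge0//.
by rewrite /en lef_pV2 ?posrE// ler_nat.
Qed.

Let damping_cvg x : damping (en n) x @[n --> \oo] --> (1 : R).
Proof.
under eq_fun do rewrite dampingE.
rewrite -expR0; apply: continuous_cvg; first exact: continuous_expR.
rewrite -[X in _ --> X](mul0r (`|x.1| + `|x.2|)); apply: cvgMl.
rewrite -oppr0; apply: cvgN; exact: cvg_harmonic.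
Qed.

Let damping_w_cvg x :
  (damping (en n) x * w x)%:E @[n --> \oo] --> (w x)%:E.
Proof.
apply: cvg_EFin; first exact: nearW.
by rewrite -[X in _ --> X]mul1r; apply: cvgMl; exact: damping_cvg.
Qed.

(** The damping increases to 1, so monotone convergence carries the bound [v_le] to the undamped
    inverse transform. Its squared modulus [w] can then dominate the errors in [approx_cvg]. *)
Let int_w_le : (\int[leb2 R]_x (w x)%:E <= M%:E)%E.
Proof.
have mg n : measurable_fun setT (fun x => (damping (en n) x * w x)%:E).
  by apply/measurable_EFinP; apply: measurable_funM => //; exact: measurable_damping.
have cv : (\int[leb2 R]_x (damping (en n) x * w x)%:E @[n --> \oo] -->
    \int[leb2 R]_x (w x)%:E)%E.
  rewrite (_ : (\int[leb2 R]_x (w x)%:E)%E =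
      (\int[leb2 R]_x limn (fun n => (damping (en n) x * w x)%:E))%E).
    apply: (@cvg_monotone_convergence _ _ _ (leb2 R) setT measurableT
      (fun n x => (damping (en n) x * w x)%:E)) => //.
      by move=> n x _; rewrite lee_fin mulr_ge0// damping_ge0.
    by move=> x _ n m nm; rewrite lee_fin ler_wpM2r// damping_nd.
  apply: eq_integral => x _; apply/esym/cvg_lim => //; exact: damping_w_cvg.
apply: (cvge_to_le cv); apply: nearW => n.
by rewrite energy// lee_fin v_le.
Qed.

Let integrable_w : (leb2 R).-integrable setT (EFin \o w).
Proof.
apply/integrableP; split; first by apply/measurable_EFinP.
under eq_integral do rewrite /= ger0_norm//.
by rewrite (le_lt_trans int_w_le)// ltry.
Qed.

Let approx_cvg : (\int[leb2 R]_x ((damping (en n) x - 1) ^+ 2 * w x)%:E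
  @[n --> \oo] --> 0)%E.
Proof.
have me n : measurable_fun setT
    (fun x => ((damping (en n) x - 1) ^+ 2 * w x)%:E).
  apply/measurable_EFinP; apply: measurable_funM => //.
  by apply: measurable_funX; apply: measurable_funB => //; exact: measurable_damping.
have f_f : {ae leb2 R, forall x, setT x ->
    (fun n => ((damping (en n) x - 1) ^+ 2 * w x)%:E) @ \oo --> 0%E}.
  apply: aeW => x _; apply: cvg_EFin; first exact: nearW.
  rewrite -[X in _ --> X](mul0r (w x)); apply: cvgMl.
  rewrite (_ : (0 : R) = (1 - 1) ^+ 2); last by rewrite subrr expr0n.
  apply: (@cvg_comp _ _ _ (fun n => damping (en n) x - 1) (fun v => v ^+ 2)).
    by apply: cvgB; [exact: damping_cvg|exact: cvg_cst].
  exact: exprn_continuous.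
have f_w : {ae leb2 R, forall x n, setT x ->
    (`|((damping (en n) x - 1) ^+ 2 * w x)%:E| <= (EFin \o w) x)%E}.
  apply: aeW => x n _; rewrite /= lee_fin normrM (ger0_norm (w_ge0 x)) ler_piMl//.
  rewrite normrX expr_le1// ler0_norm ?subr_le0 ?damping_le1//.
  by rewrite opprB lerBlDr lerDl damping_ge0.
have [_ _] := dominated_convergence measurableT me
  (@measurable_cst _ _ _ _ setT 0%E) f_f integrable_w f_w.
by rewrite integral0.
Qed.

(** The square of half-side [d] about [z] lies in [S], so [u e z] is at least the mass of the kernel
    on it, a product of two equal one-dimensional masses. *)
Let u_lower e d z : 0 < e -> 0 < d ->
  (forall y, `|y.1 - z.1| <= d -> `|y.2 - z.2| <= d -> S y) ->
  (2 / pi * atan (2 * pi / e * d)) ^+ 2 <= u e z.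
Proof.
move=> e0 d0 hd; rewrite -lee_fin uE// expr2 EFinM.
rewrite -(integral_cauchy_segment e0 d0).
pose p (x : measurableTypeR R) : R := \1_(`[- d, d]%classic) x * cauchy_kernel e x.
have mp : measurable_fun setT p.
  by apply: measurable_funM; [exact: measurable_indic|exact: measurable_cauchy].
have p0 x : 0 <= p x.
  by rewrite /p indicE mulr_ge0// cauchy_kernel_ge0.
rewrite -(shifted_tensor z mp mp p0 p0).
have mpp : measurable_fun setT (fun y : plane R => p (y.1 - z.1) * p (y.2 - z.2)).
  have h : measurable_fun setT (fun y : plane R => p y.1 * p y.2).
    apply: measurable_funM.
      exact: (measurableT_comp mp measurable_fst).
    exact: (measurableT_comp mp measurable_snd).
  exact: (measurableT_comp h (measurable_sub1 z)).
apply: ge0_le_integral => //.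
- by move=> y _; rewrite lee_fin mulr_ge0.
- exact/measurable_EFinP.
- apply/measurable_EFinP.
  exact: (measurableT_comp (measurable_sK e0) (measurable_pair1 z)).
- move=> y _; rewrite lee_fin /p /kernel2 /= !indicE.
  case: (boolP (y.1 - z.1 \in _)) => h1; last by rewrite !mul0r sK_ge0.
  case: (boolP (y.2 - z.2 \in _)) => h2; last by rewrite mul0r mulr0 sK_ge0.
  rewrite /s indicE mem_set ?mul1r//.
  by apply: hd; [move: h1|move: h2]; rewrite inE/= in_itv/= ler_norml.
Qed.

Let u_cvg z : O z -> u (en n) z @[n --> \oo] --> (1 : R).
Proof.
move=> /intO[d d0 hd].
have pi0 := @pi_gt0 R.
have lo : (2 / pi * atan (2 * pi / en n * d)) ^+ 2 @[n --> \oo] --> (1 : R).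
  have c1 : 2 / pi * atan (2 * pi / en n * d) @[n --> \oo] --> (1 : R).
    rewrite [X in _ --> X](_ : 1 = 2 / pi * (pi / 2)); last first.
      by rewrite mulrA divfK ?gt_eqF// mulfV.
    apply: cvgMr.
    apply: (@cvg_comp _ _ _ (fun n => 2 * pi / en n * d) atan _ (pinfty_nbhs R));
      last exact: cvgy_atan.
    have -> : (fun n => 2 * pi / en n * d) = (fun n => (2 * pi * d) * n.+1%:R).
      by apply/funext => n; rewrite /en invrK; ring.
    by apply: cvg_scale_nat; rewrite !mulr_gt0.
  rewrite -[X in _ --> X](expr1n R 2).
  apply: (@cvg_comp _ _ _ (fun n => 2 / pi * atan (2 * pi / en n * d)) (fun v => v ^+ 2)).
    exact: c1.
  exact: exprn_continuous.
apply: (squeeze_cvgr _ lo (cvg_cst (1 : R))).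
by apply: nearW => n; rewrite u_le1// andbT u_lower.
Qed.

Let v_cvg : (v (en n))%:E @[n --> \oo] --> M%:E.
Proof.
have me n : measurable_fun setT (fun z => (s z * u (en n) z)%:E).
  by apply/measurable_EFinP; apply: measurable_funM => //; exact: mu_.
have f_f : {ae leb2 R, forall z, setT z ->
    (fun n => (s z * u (en n) z)%:E) @ \oo --> (EFin \o s) z}.
  (* Outside [S] the sequence is constantly 0, and on [O] it converges by [u_cvg]; only points of
     [S] outside [O] are exceptional. *)
  apply: negligibleS nullSO => z /= nz; split.
    apply: contrapT => nS; apply: nz => _.
    rewrite /s indicE memNset//; under eq_fun do rewrite mul0r.
    exact: cvg_cst.
  move=> Oz; apply: nz => _; apply: cvg_EFin; first exact: nearW.
  by rewrite -[X in _ --> X]mulr1; apply: cvgMr; exact: u_cvg.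
have f_s : {ae leb2 R, forall z n, setT z ->
    (`|(s z * u (en n) z)%:E| <= (EFin \o s) z)%E}.
  apply: aeW => x n _; rewrite /= lee_fin ger0_norm ?mulr_ge0 ?u_ge0//.
  by rewrite ler_piMr// u_le1.
have [_ _] := dominated_convergence measurableT me (measurable_int _ is_)
  f_f is_ f_s.
by move=> h; rewrite -int_s; under eq_fun do rewrite vE//; exact: h.
Qed.

Let target_cvg : (\int[leb2 R]_z ((u (en n) z - s z) ^+ 2)%:E @[n --> \oo] --> 0)%E.
Proof.
have ub n : (\int[leb2 R]_z ((u (en n) z - s z) ^+ 2)%:E <=
    (M + M - 2 * v (en n))%:E)%E.
  have iu := integrable_u (en0 n).
  have isu := integrable_su (en0 n).
  (* [q] dominates [(u - s) ^+ 2] because [u ^+ 2 <= u] and [s ^+ 2 = s], and its integral is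
     explicit in [v]. *)
  pose q z := u (en n) z + s z - 2 * (s z * u (en n) z).
  have i1 : (leb2 R).-integrable setT (EFin \o (fun z => u (en n) z + s z)).
    exact: (integrableD measurableT iu is_).
  have i2 : (leb2 R).-integrable setT (EFin \o (fun z => 2 * (s z * u (en n) z))).
    exact: (integrableZl measurableT 2 isu).
  have iq : (leb2 R).-integrable setT (EFin \o q).
    exact: (integrableB measurableT i1 i2).
  have <- : (\int[leb2 R]_z (q z)%:E = (M + M - 2 * v (en n))%:E)%E.
    rewrite -[LHS]fineK; last exact: (integrable_fin_num measurableT iq).
    rewrite -[fine _]/(\int[leb2 R]_z q z); congr EFin.
    rewrite RintegralB// RintegralD// RintegralZl//.
    by rewrite /Rintegral integral_u// int_s.
  apply: ge0_le_integral => //.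
  - by move=> z _; rewrite lee_fin sqr_ge0.
  - apply/measurable_EFinP; apply: measurable_funX; apply: measurable_funB => //.
    exact: mu_.
  - exact: (measurable_int _ iq).
  - move=> z _; rewrite lee_fin /q.
    have := u_ge0 z (en0 n); have := u_le1 z (en0 n).
    by rewrite /s indicE; case: (z \in S); rewrite /= => *; nra.
have lim0 : (M + M - 2 * v (en n))%:E @[n --> \oo] --> 0%E.
  apply: cvg_EFin; first exact: nearW.
  rewrite (_ : 0 = M + M - 2 * M); last by ring.
  apply: cvgB; first exact: cvg_cst.
  by apply: cvgMr; have /fine_cvg := v_cvg.
apply: (squeeze_cvge _ (cvg_cst (0 : \bar R)%E) lim0).
apply: nearW => n; rewrite ub andbT; apply: integral_ge0 => z _.
by rewrite lee_fin sqr_ge0.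
Qed.

Let integrable_damping_bounded e (b : plane R -> R) (c : R) : 0 < e ->
  measurable_fun setT b -> (forall x, `|b x| <= c) ->
  (leb2 R).-integrable setT (EFin \o (fun x => damping e x * b x)).
Proof.
move=> e0 mb bc.
apply: (le_integrable _ _ _ (integrableZl measurableT c (integrable_damping e0))) => //.
  by apply/measurable_EFinP; apply: measurable_funM => //; exact: measurable_damping.
move=> x _ /=; rewrite lee_fin normrM (ger0_norm (damping_ge0 _ _)) mulrC.
by rewrite (le_trans _ (ler_norm _))// ler_wpM2r ?damping_ge0.
Qed.

Let cvg_scale_integral (a : R) (q : nat -> plane R -> R) :
  (forall n, measurable_fun setT (q n)) -> (forall n x, 0 <= q n x) ->
  (\int[leb2 R]_x (q n x)%:E @[n --> \oo] --> 0)%E ->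
  (\int[leb2 R]_x (a ^+ 2 * q n x)%:E @[n --> \oo] --> 0)%E.
Proof.
move=> mq q0 h.
rewrite (_ : (fun n => _) =
    (fun n => (a ^+ 2)%:E * \int[leb2 R]_x (q n x)%:E)%E).
  by rewrite -(mule0 (a ^+ 2)%:E); exact: cvgeZl.
apply/funext => n; under eq_integral do rewrite EFinM.
rewrite ge0_integralZl//.
- exact/measurable_EFinP.
- by move=> x _; rewrite lee_fin.
- by rewrite lee_fin sqr_ge0.
Qed.

(** The factor [a] leaves room for the normalization by the Haar measure of a unit arc. *)
Lemma fourier_L2_indicator (a : R) : exists psi : plane R -> R[i],
  fourier_L2 psi (fun z => (a * \1_S z) +i* 0).
Proof.
have intM : (M%:E < +oo :> \bar R)%E by exact: ltry.
(* Damping makes these integrable, as [A] and [B] are bounded by [M]; they are in L2 because the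
   damping is at most 1 and [w] is integrable. *)
pose f_ n x : R[i] := (a * (damping (en n) x * A x)) +i* (a * (damping (en n) x * B x)).
have mfA n : measurable_fun setT (fun x => a * (damping (en n) x * A x)).
  by do 2 apply: measurable_funM => //; exact: measurable_damping.
have mfB n : measurable_fun setT (fun x => a * (damping (en n) x * B x)).
  by do 2 apply: measurable_funM => //; exact: measurable_damping.
have mc z : measurable_fun setT (fun x : plane R => cos (phase x z)).
  apply: (measurableT_comp (continuous_measurable_fun (@continuous_cos R))).
  exact: measurable_phase1.
have msn z : measurable_fun setT (fun x : plane R => sin (phase x z)).
  apply: (measurableT_comp (continuous_measurable_fun (@continuous_sin R))).
  exact: measurable_phase1.
have bnd (p q c1 c2 : R) : `|p| <= M -> `|q| <= M -> `|c1| <= 1 -> `|c2| <= 1 ->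
    `|p * c1 + q * c2| <= 2 * M.
  move=> pM qM h1 h2; rewrite (le_trans (ler_normD _ _))// mulr_natl mulr2n.
  by rewrite lerD// normrM -[leRHS]mulr1 ler_pM.
have ft n z : fourier_L1 (f_ n) z = (a * u (en n) z) +i* 0.
  rewrite /fourier_L1 /cintegral; congr (_ +i* _).
    rewrite -(fourier_re z (en0 n)) -RintegralZl//.
      apply: eq_Rintegral => x _.
      by rewrite /f_ /expi /= cosN sinN /phase; ring.
    apply: (@integrable_damping_bounded _ _ (2 * M)) => //.
      by apply: measurable_funD; apply: measurable_funM.
    by move=> x; apply: bnd => //; [exact: cos_max|exact: sin_max].
  rewrite -[RHS](mulr0 a) -(fourier_im z (en0 n)) -RintegralZl//.
    apply: eq_Rintegral => x _.
    by rewrite /f_ /expi /= cosN sinN /phase; ring.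
  apply: (@integrable_damping_bounded _ _ (2 * M)) => //.
    by apply: measurable_funB; apply: measurable_funM.
  move=> x; rewrite -mulNr; apply: bnd => //; first by rewrite normrN.
    exact: cos_max.
  exact: sin_max.
exists (fun x => (a * A x) +i* (a * B x)); split.
- split; first by split; apply: measurable_funM.
  under eq_integral do rewrite cnorm_sqr !exprMn -mulrDr EFinM.
  rewrite ge0_integralZl//.
  + by rewrite lte_mul_pinfty// ?lee_fin ?sqr_ge0//; exact: le_lt_trans int_w_le _.
  + exact/measurable_EFinP.
  + by move=> x _; rewrite lee_fin w_ge0.
  + by rewrite lee_fin sqr_ge0.
- split; first by split; [exact: measurable_funM|exact: measurable_cst].
  have s_sqr x : (a * \1_S x) ^+ 2 + 0 ^+ 2 = a ^+ 2 * s x.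
    rewrite expr0n/= addr0 exprMn /s indicE.
    by case: (x \in S); rewrite ?expr1n ?expr0n.
  under eq_integral do rewrite cnorm_sqr s_sqr EFinM.
  rewrite ge0_integralZl//.
  + by rewrite int_s -EFinM ltry.
  + exact/measurable_EFinP.
  + by move=> x _; rewrite lee_fin.
  + by rewrite lee_fin sqr_ge0.
- exists f_; split.
  + move=> n; have cm : cmeasurable (f_ n) by split; [exact: mfA|exact: mfB].
    split; split => //.
    * have := integrableZr measurableT (`|a| * (2 * M)) (integrable_damping (en0 n)).
      move=> /integrableP[_] h; apply: le_lt_trans h; apply: ge0_le_integral => //.
      - by move=> x _; rewrite lee_fin cnorm_ge0.
      - apply/measurable_EFinP; rewrite /cnorm /ComplexField.Normc.normc /f_ /=.
        apply: (measurableT_comp (continuous_measurable_fun (@sqrt_continuous R))).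
        by apply: measurable_funD; exact: measurable_funX.
      - apply: measurableT_comp => //; apply/measurable_EFinP.
        by apply: measurable_funM => //; exact: measurable_damping.
      - move=> x _ /=; rewrite lee_fin (le_trans (cnorm_le _ _))//.
        rewrite [leRHS]ger0_norm; last first.
          by apply: mulr_ge0; [exact: damping_ge0|rewrite !mulr_ge0].
        rewrite [X in X + _]normrM [X in _ + X]normrM -mulrDr mulrCA.
        rewrite ler_wpM2l// [X in X + _]normrM [X in _ + X]normrM -mulrDr.
        rewrite (ger0_norm (damping_ge0 _ _)) ler_wpM2l ?damping_ge0//.
        by rewrite mulr_natl mulr2n lerD.
    * have := integrableZl measurableT (a ^+ 2) integrable_w.
      move=> /integrableP[_] h; apply: le_lt_trans h; apply: ge0_le_integral => //.
      - by move=> x _; rewrite lee_fin sqr_ge0.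
      - apply/measurable_EFinP; rewrite (_ : (fun x => _) = (fun x =>
          (a * (damping (en n) x * A x)) ^+ 2 + (a * (damping (en n) x * B x)) ^+ 2)).
          by apply: measurable_funD; exact: measurable_funX.
        by apply/funext => x; rewrite cnorm_sqr.
      - by apply: measurableT_comp => //; apply/measurable_EFinP; exact: measurable_funM.
      - move=> x _.
        have aw0 : 0 <= a ^+ 2 * w x by apply: mulr_ge0; [exact: sqr_ge0|exact: w_ge0].
        rewrite /= lee_fin cnorm_sqr (ger0_norm aw0).
        have -> : (a * (damping (en n) x * A x)) ^+ 2 +
            (a * (damping (en n) x * B x)) ^+ 2 =
            a ^+ 2 * (damping (en n) x ^+ 2 * w x) by rewrite /w; ring.
        rewrite ler_wpM2l ?sqr_ge0//; apply: ler_piMl; first exact: (w_ge0 x).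
        by rewrite expr_le1 ?damping_ge0// damping_le1.
  + have h : (\int[leb2 R]_x (a ^+ 2 * ((damping (en n) x - 1) ^+ 2 * w x))%:E
        @[n --> \oo] --> 0)%E.
      apply: (@cvg_scale_integral a (fun n x => (damping (en n) x - 1) ^+ 2 * w x)).
      - move=> m; apply: measurable_funM => //.
        by apply: measurable_funX; apply: measurable_funB => //; exact: measurable_damping.
      - by move=> m x; rewrite mulr_ge0// sqr_ge0.
      - exact: approx_cvg.
    have E : (fun k => \int[leb2 R]_x (cnorm (f_ k x -
        ((a * A x) +i* (a * B x))) ^+ 2)%:E)%E = (fun n =>
      (\int[leb2 R]_x (a ^+ 2 * ((damping (en n) x - 1) ^+ 2 * w x))%:E)%E).
      apply/funext => n; apply: eq_integral => x _.
      rewrite -[X in cnorm X]/((a * (damping (en n) x * A x) - a * A x) +i*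
        (a * (damping (en n) x * B x) - a * B x)).
      by rewrite cnorm_sqr /w; congr EFin; ring.
    by move: h; rewrite -E; exact.
  + have h : (\int[leb2 R]_z (a ^+ 2 * (u (en n) z - s z) ^+ 2)%:E
        @[n --> \oo] --> 0)%E.
      apply: (@cvg_scale_integral a (fun n z => (u (en n) z - s z) ^+ 2)).
      - by move=> m; apply: measurable_funX; apply: measurable_funB => //; exact: mu_.
      - by move=> m z; exact: sqr_ge0.
      - exact: target_cvg.
    have E : (fun k => \int[leb2 R]_z (cnorm (fourier_L1 (f_ k) z -
        ((a * \1_S z) +i* 0)) ^+ 2)%:E)%E = (fun n =>
      (\int[leb2 R]_z (a ^+ 2 * (u (en n) z - s z) ^+ 2)%:E)%E).
      apply/funext => n; apply: eq_integral => z _.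
      rewrite ft -[X in cnorm X]/((a * u (en n) z - a * s z) +i* (0 - 0)).
      by rewrite cnorm_sqr; congr EFin; ring.
    by move: h; rewrite -E; exact.
Qed.

End fourier_indicator.

(** * Groups of matrices of trace zero *)

Section linear_action.
Context {R : realType}.
Implicit Types (a b : 'M[R]_2) (x : plane R).

(** The transpose makes this a right action, whence the order in [actM]. *)
Definition act a x := mxact a^T x.

Lemma actE a x : act a x =
  (a ord0 ord0 * x.1 + a ord_max ord0 * x.2,
   a ord0 ord_max * x.1 + a ord_max ord_max * x.2).
Proof. by rewrite /act /mxact !mxE. Qed.

Lemma actM a b x : act (a *m b) x = act b (act a x).
Proof. by rewrite !actE !mxE2 /=; congr pair; ring. Qed.

Lemma act1 x : act 1%:M x = x.
Proof.
by case: x => u v; rewrite actE !mxE/= !mul1r !mul0r addr0 add0r.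
Qed.

Lemma actZ a (c : R) x : act a (c * x.1, c * x.2) = (c * (act a x).1, c * (act a x).2).
Proof. by rewrite !actE /=; congr pair; ring. Qed.

Lemma scales_area_act a : \det a != 0 -> scales_area (act a) `|\det a|.
Proof.
rewrite det2E mulrC => D0.
rewrite (_ : act a = (fun x => (a ord0 ord0 * x.1 + a ord_max ord0 * x.2,
   a ord0 ord_max * x.1 + a ord_max ord_max * x.2))); last first.
  by apply/funext => x; rewrite actE.
have h : a ord0 ord0 * a ord_max ord_max - a ord_max ord0 * a ord0 ord_max =
    a ord_max ord_max * a ord0 ord0 - a ord0 ord_max * a ord_max ord0 by ring.
by rewrite -h; apply: scales_area_linear; rewrite h.
Qed.

Lemma scales_area_homothety (c : R) : c != 0 ->
  scales_area (fun x => (c * x.1, c * x.2)) (c ^+ 2).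
Proof.
move=> c0; have := @scales_area_linear R c 0 0 c.
rewrite mul0r subr0 mulf_neq0// => /(_ isT).
rewrite -expr2 ger0_norm ?sqr_ge0// (_ : (fun x => _) = (fun x => (c * x.1, c * x.2)))//.
by apply/funext => x; rewrite !mul0r addr0 add0r.
Qed.

(* For a matrix of determinant 1 this is the action of the inverse; being
   polynomial in the entries, it is visibly Borel. *)
Definition adj_act a x : plane R :=
  (a ord_max ord_max * x.1 - a ord_max ord0 * x.2,
   - a ord0 ord_max * x.1 + a ord0 ord0 * x.2).

Lemma adj_act_inv a b x : b *m a = 1%:M -> \det a = 1 -> adj_act a x = act b x.
Proof.
move=> ba; rewrite det2E => da.
have e00 := congr1 (fun m : 'M[R]_2 => m ord0 ord0) ba.
have e01 := congr1 (fun m : 'M[R]_2 => m ord0 ord_max) ba.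
have e10 := congr1 (fun m : 'M[R]_2 => m ord_max ord0) ba.
have e11 := congr1 (fun m : 'M[R]_2 => m ord_max ord_max) ba.
rewrite !mxE2 !mxE/= ?mulr1n ?mulr0n in e00 e01 e10 e11.
rewrite actE /adj_act.
have -> : b ord0 ord0 = a ord_max ord_max.
  transitivity ((b ord0 ord0 * a ord0 ord0 + b ord0 ord_max * a ord_max ord0) * a ord_max ord_max -
    (b ord0 ord0 * a ord0 ord_max + b ord0 ord_max * a ord_max ord_max) * a ord_max ord0);
      first by rewrite -[LHS]mulr1 -da; ring.
  by rewrite e00 e01; ring.
have -> : b ord0 ord_max = - a ord0 ord_max.
  transitivity ((b ord0 ord0 * a ord0 ord_max + b ord0 ord_max * a ord_max ord_max) * a ord0 ord0 -
    (b ord0 ord0 * a ord0 ord0 + b ord0 ord_max * a ord_max ord0) * a ord0 ord_max);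
      first by rewrite -[LHS]mulr1 -da; ring.
  by rewrite e00 e01; ring.
have -> : b ord_max ord0 = - a ord_max ord0.
  transitivity ((b ord_max ord0 * a ord0 ord0 + b ord_max ord_max * a ord_max ord0) * a ord_max ord_max -
    (b ord_max ord0 * a ord0 ord_max + b ord_max ord_max * a ord_max ord_max) * a ord_max ord0);
      first by rewrite -[LHS]mulr1 -da; ring.
  by rewrite e10 e11; ring.
have -> : b ord_max ord_max = a ord0 ord0.
  transitivity ((b ord_max ord0 * a ord0 ord_max + b ord_max ord_max * a ord_max ord_max) * a ord0 ord0 -
    (b ord_max ord0 * a ord0 ord0 + b ord_max ord_max * a ord_max ord0) * a ord0 ord_max);
      first by rewrite -[LHS]mulr1 -da; ring.
  by rewrite e10 e11; ring.
by congr pair; ring.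
Qed.

Lemma measurable_adj_act (d : measure_display) (T : measurableType d)
    (a : T -> borel_mx R) (x : T -> plane R) :
  measurable_fun setT a -> measurable_fun setT x ->
  measurable_fun setT (fun u => adj_act (a u) (x u)).
Proof.
move=> ma mx.
have me i j : measurable_fun setT (fun u => (a u : 'M[R]_2) i j : R).
  exact: (measurableT_comp (measurable_mx_entry i j)).
have m1 : measurable_fun setT (fun u => (x u).1 : R) by exact: measurableT_comp.
have m2 : measurable_fun setT (fun u => (x u).2 : R) by exact: measurableT_comp.
apply/measurable_fun_pairP; split.
  by apply: measurable_funB; apply: measurable_funM.
by apply: measurable_funD; apply: measurable_funM => //; exact: measurableT_comp.
Qed.

End linear_action.

Section unimodular.
Local Open Scope ereal_scope.
Context {R : realType} (X : 'M[R]_2) (mu : {measure set (borel_mx R) -> \bar R}).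
Hypothesis hmu : left_haar (one_param_group X) mu.
Hypothesis trX : (\tr X = 0)%R.
Local Notation BM := (borel_mx R).
Local Notation G := (one_param_group X).
Local Notation E t := (expmx (t%R *: X)%R).

Let mus : {sigma_finite_measure set BM -> \bar R} :=
  sigma_finite_pack (haar_sigma_finite hmu).

(** Integrands are compared along the group only, where identities such as [adjE] hold; the other
    matrices form a null set. *)
Lemma haar_integral_eq (f g : BM -> \bar R) :
  measurable_fun setT f -> measurable_fun setT g ->
  (forall a, 0 <= f a) -> (forall a, 0 <= g a) ->
  (forall t, f (E t) = g (E t)) -> \int[mu]_a f a = \int[mu]_a g a.
Proof.
move=> mf mg f0 g0 fg.
have mC := measurableC (measurable_one_param_group X).
have nC := haar_setC0 hmu.
rewrite (ge0_negligible_integral mC _ mf _ nC)//.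
rewrite (ge0_negligible_integral mC _ mg _ nC)//.
apply: eq_integral => a; rewrite inE => -[_] /contrapT [t _ <-].
exact: fg.
Qed.

Lemma haar_integral_restrict (f : BM -> \bar R) :
  measurable_fun setT f -> (forall a, 0 <= f a) ->
  \int[mu]_(a in (G : set BM)) f a = \int[mu]_a f a.
Proof.
move=> mf f0.
have mC := measurableC (measurable_one_param_group X).
rewrite [RHS](ge0_negligible_integral mC _ mf _ (haar_setC0 hmu))//.
by rewrite setDE setTI setCK.
Qed.

Let detE t : (\det (E t) = 1)%R.
Proof. by rewrite det_expmx trX mul0r expR0. Qed.

Let adjE t x : adj_act (E t) x = act (E (- t)) x.
Proof. by apply: adj_act_inv; [exact: expmxNV|exact: detE]. Qed.

Let act_scale t (f : plane R -> \bar R) : measurable_fun setT f ->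
  (forall x, 0 <= f x) -> \int[leb2 R]_x f (act (E t) x) = \int[leb2 R]_x f x.
Proof.
move=> mf f0.
have [_ h] : scales_area (act (E t)) `|\det (E t)|%R.
  by apply: scales_area_act; rewrite detE oner_eq0.
by rewrite h// detE normr1 invr1 mul1e.
Qed.

Variable h : plane R -> \bar R.
Hypotheses (mh : measurable_fun setT h) (h0 : forall x, 0 <= h x).

Let D x := \int[mu]_a h (act a x).
Let k x := \int[mu]_a h (adj_act a x).

Let m_act (d : measure_display) (T : measurableType d)
    (a : T -> BM) (x : T -> plane R) :
  measurable_fun setT a -> measurable_fun setT x ->
  measurable_fun setT (fun u => h (act (a u) (x u))).
Proof. by move=> ma mx; apply: (measurableT_comp mh); exact: measurable_mxact_tr. Qed.

Let m_adj (d : measure_display) (T : measurableType d)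
    (a : T -> BM) (x : T -> plane R) :
  measurable_fun setT a -> measurable_fun setT x ->
  measurable_fun setT (fun u => h (adj_act (a u) (x u))).
Proof. by move=> ma mx; apply: (measurableT_comp mh); exact: measurable_adj_act. Qed.

(** By [actM], moving the point is a left translation of the integration variable. *)
Let D_invariant t x : D (act (E t) x) = D x.
Proof.
rewrite /D -(haar_integral_translate hmu t (f := fun a : BM => h (act a x)))//.
  by apply: eq_integral => a _; rewrite actM.
by apply: m_act.
Qed.

Let k_eq1 x x0 : D x = 1 -> D x0 = 1 -> k x = 1.
Proof.
move=> Dx Dx0.
pose F (p : BM * BM) := h (adj_act p.2 x) * h (act p.1 (act p.2 x0)).
have mF : measurable_fun setT F.
  apply: emeasurable_funM; first by apply: m_adj.
  apply: m_act => //.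
  by apply: measurable_mxact_tr.
have F0 p : 0 <= F p by rewrite mule_ge0.
pose F' (p : BM * BM) := h (act p.1 (adj_act p.2 x)) * h (act p.2 x0).
have mF' : measurable_fun setT F'.
  apply: emeasurable_funM; last by apply: m_act.
  apply: m_act => //.
  by apply: measurable_adj_act.
have F'0 p : 0 <= F' p by rewrite mule_ge0.
transitivity (\int[mu]_b \int[mu]_a F (a, b)).
  apply: haar_integral_eq => //.
  - exact: m_adj.
  - exact: (@measurable_fun_fubini_tonelli_G _ _ _ _ _ mus F).
  - by move=> b; apply: integral_ge0.
  - move=> t; rewrite /F /= ge0_integralZl//.
    + by rewrite -/(D (act (E t) x0)) D_invariant Dx0 mule1.
    + exact: m_act.
transitivity (\int[mu]_a \int[mu]_b F (a, b)).
  exact/esym/(@fubini_tonelli _ _ _ _ _ mus mus F).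
transitivity (\int[mu]_a \int[mu]_b F' (a, b)).
  apply: haar_integral_eq => //.
  - exact: (@measurable_fun_fubini_tonelli_F _ _ _ _ _ mus F).
  - exact: (@measurable_fun_fubini_tonelli_F _ _ _ _ _ mus F').
  - by move=> b; apply: integral_ge0.
  - by move=> b; apply: integral_ge0.
  - move=> t.
    have mFt : measurable_fun setT (fun b : BM => F (E t : BM, b)).
      exact: (measurableT_comp mF (measurable_pair1 (E t : BM))).
    (* Replacing [b] by [E (- t) *m b] moves [a = E t] from the factor at [x0] to the factor at [x];
       the times combine because the group is commutative. *)
    rewrite -(haar_integral_translate hmu (- t) mFt)//.
    apply: haar_integral_eq => //.
    + exact: (measurableT_comp mFt (measurable_mulmx (E (- t)))).
    + exact: (measurableT_comp mF' (measurable_pair1 (E t : BM))).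
    + move=> s; rewrite /F /F' /= -expmxD !adjE -!actM -!expmxD.
      by rewrite opprD opprK [(t - s)%R]addrC addrAC addNr add0r.
transitivity (\int[mu]_b \int[mu]_a F' (a, b)).
  exact: (@fubini_tonelli _ _ _ _ _ mus mus F').
rewrite -Dx0; apply: haar_integral_eq => //.
- exact: (@measurable_fun_fubini_tonelli_G _ _ _ _ _ mus F').
- exact: m_act.
- by move=> b; apply: integral_ge0.
- move=> t; rewrite /F' /= ge0_integralZr//.
  + by rewrite adjE -/(D (act (E (- t)) x)) D_invariant Dx mul1e.
  + exact: m_act.
Qed.

Hypothesis hfin : \int[leb2 R]_x h x < +oo.
Hypothesis aeD : {ae leb2 R, forall x, D x = 1}.

Let leb2_setT : leb2 R setT != 0.
Proof.
apply/eqP => h1.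
have : leb2 R (`[0%R, 1%R]%classic `*` `[0%R, 1%R]%classic) <= leb2 R setT.
  by apply: le_measure; rewrite ?inE//; exact: measurableX.
have l01 : (@lebesgue_measure R) `[0%R, 1%R]%classic = 1.
  by rewrite lebesgue_measure_itv/= lte_fin ltr01 sube0.
rewrite h1 [leb2 R _]product_measure1E// [X in X * _]l01 [X in _ * X]l01 mul1e.
by rewrite lee_fin ler10.
Qed.

(** Supplies the base point of [k_eq1]; the plane is not a null set. *)
Let leb2_ae_ex (P : plane R -> Prop) : {ae leb2 R, forall x, P x} -> exists x, P x.
Proof.
move=> aeP; apply: contrapT => nP.
have : (leb2 R).-negligible setT.
  by apply: negligibleS aeP => x _ /= Px; apply: nP; exists x.
by move/(measure_negligible measurableT)/eqP; exact/negP/leb2_setT.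
Qed.

Let dilate (x : plane R) : plane R := (2 * x.1, 2 * x.2)%R.

Let m_dilate : measurable_fun setT dilate.
Proof.
by have [] := @scales_area_homothety R 2 _.
Qed.

Let integral_dilate (f : plane R -> \bar R) : measurable_fun setT f ->
  (forall x, 0 <= f x) ->
  \int[leb2 R]_x f (dilate x) = (4^-1)%:E * \int[leb2 R]_x f x.
Proof.
move=> mf f0; have [_ hh] := @scales_area_homothety R 2 (lt0r_neq0 (ltr0n _ 2)).
by rewrite [LHS]hh//; congr (_%:E * _); congr (_^-1)%R; rewrite -natrX.
Qed.

Let aeD2 : {ae leb2 R, forall x, D (dilate x) = 1}.
Proof.
have [N [mN N0 DN]] := aeD.
have mP : measurable (dilate @^-1` N).
  by rewrite -[X in measurable X]setTI; exact: m_dilate.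
exists (dilate @^-1` N); split => //; last by move=> x /= nD; apply: DN.
have : \int[leb2 R]_x (\1_(dilate @^-1` N) x)%:E = 0.
  transitivity (\int[leb2 R]_x (EFin \o (\1_N : plane R -> R)) (dilate x)) => //.
  rewrite integral_dilate//.
  - by rewrite [X in _ * X]integral_indic// setIT [X in _ * X]N0 mule0.
  - by apply/measurable_EFinP; exact: measurable_indic.
  - by move=> x; rewrite lee_fin.
by rewrite integral_indic// setIT.
Qed.

Lemma unimodular_no_section : False.
Proof.
have [x0 Dx0] := leb2_ae_ex aeD.
have aek : {ae leb2 R, forall x, k x = 1}.
  by apply: filterS aeD => x Dx; exact: k_eq1 Dx Dx0.
pose F (p : plane R * BM) := h p.1 * h (act p.2 (dilate p.1)).
have md : measurable_fun setT (fun p : plane R * BM => dilate p.1).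
  exact: (measurableT_comp m_dilate measurable_fst).
have mF : measurable_fun setT F.
  apply: emeasurable_funM; first exact: (measurableT_comp mh measurable_fst).
  exact: m_act.
have F0 p : 0 <= F p by rewrite mule_ge0.
pose F' (p : plane R * BM) := h (adj_act p.2 p.1) * h (dilate p.1).
have mF' : measurable_fun setT F'.
  apply: emeasurable_funM; first exact: m_adj.
  exact: (measurableT_comp mh md).
have F'0 p : 0 <= F' p by rewrite mule_ge0.
have mD : measurable_fun setT D.
  apply: (@measurable_fun_fubini_tonelli_F _ _ _ _ _ mus
    (fun p : plane R * BM => h (act p.2 p.1))) => //.
  exact: m_act.
have mk : measurable_fun setT k.
  apply: (@measurable_fun_fubini_tonelli_F _ _ _ _ _ mus
    (fun p : plane R * BM => h (adj_act p.2 p.1))) => //.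
  exact: m_adj.
have D0 x : 0 <= D x by apply: integral_ge0.
have k0 x : 0 <= k x by apply: integral_ge0.
have E1 : \int[leb2 R]_x h x = (4^-1)%:E * \int[leb2 R]_x h x.
  rewrite -integral_dilate//.
  transitivity (\int[leb2 R]_x \int[mu]_a F (x, a)).
    apply: ge0_ae_eq_integral => //.
    - exact: (@measurable_fun_fubini_tonelli_F _ _ _ _ _ mus F).
    - by move=> x _; apply: integral_ge0.
    - apply: filterS aeD2 => x Dx _; rewrite /F /= ge0_integralZl//.
        by rewrite -/(D (dilate x)) Dx mule1.
      exact: m_act.
  transitivity (\int[mu]_a \int[leb2 R]_x F (x, a)).
    exact: (@fubini_tonelli _ _ _ _ _ lebp mus F).
  transitivity (\int[mu]_a \int[leb2 R]_x F' (x, a)).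
    apply: haar_integral_eq.
    - exact: (@measurable_fun_fubini_tonelli_G _ _ _ _ _ lebp F).
    - exact: (@measurable_fun_fubini_tonelli_G _ _ _ _ _ lebp F').
    - by move=> a; apply: integral_ge0.
    - by move=> a; apply: integral_ge0.
    - move=> t.
      have mFt : measurable_fun setT (fun x => F (x, E t : BM)).
        exact: (measurableT_comp mF (measurable_pair2 (E t : BM))).
      (* Area-preserving substitution of [act (E (- t)) x] for [x]. It cancels the matrix in the
         second factor, since the dilation commutes with the action, and puts its inverse into the
         first. *)
      rewrite -(act_scale (- t) mFt)//; apply: eq_integral => x _.
      have dz a y : dilate (act a y) = act a (dilate y) by rewrite /dilate actZ.
      by rewrite /F /F' /= adjE dz -actM -expmxD addNr expmx0 act1.
  transitivity (\int[leb2 R]_x \int[mu]_a F' (x, a)).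
    exact/esym/(@fubini_tonelli _ _ _ _ _ lebp mus F').
  apply: ge0_ae_eq_integral => //.
  - exact: (@measurable_fun_fubini_tonelli_F _ _ _ _ _ mus F').
  - exact: (measurableT_comp mh m_dilate).
  - by move=> x _; apply: integral_ge0.
  - apply: filterS aek => x kx _; rewrite /F' /= ge0_integralZr//.
      by rewrite -/(k x) kx mul1e.
    exact: m_adj.
have I0 : \int[leb2 R]_x h x = 0.
  move: E1 hfin; have : 0 <= \int[leb2 R]_x h x by apply: integral_ge0.
  case: (\int[leb2 R]_x h x) => // r; rewrite lee_fin => r0.
  by rewrite -EFinM => -[rE] _; congr EFin; lra.
(* The contradiction: integrating over the plane first gives 0 for each group element, although [D]
   is 1 almost everywhere. *)
have : \int[leb2 R]_x D x = 0.
  transitivity (\int[mu]_a \int[leb2 R]_x h (act a x)).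
    apply: (@fubini_tonelli _ _ _ _ _ lebp mus
    (fun p : plane R * BM => h (act p.2 p.1))) => //.
    exact: m_act.
  transitivity (\int[mu]_a (cst 0 a)).
    apply: haar_integral_eq => //.
    - apply: (@measurable_fun_fubini_tonelli_G _ _ _ _ _ lebp
        (fun p : plane R * BM => h (act p.2 p.1))) => //.
      exact: m_act.
    - by move=> a; apply: integral_ge0.
    - by move=> t; rewrite act_scale.
  by rewrite integral0.
rewrite (_ : \int[leb2 R]_x D x = \int[leb2 R]_x (cst 1 x)); last first.
  by apply: ge0_ae_eq_integral => //; apply: filterS aeD => x ->.
rewrite integral_cst// mul1e => /eqP; exact/negP/leb2_setT.
Qed.

End unimodular.

(** * Level sets of quadratic forms *)

Section quadratic_level_sets.
Context {R : realType}.
Local Notation leb := (@lebesgue_measure R).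
Local Notation RR := (measurableTypeR R).

(** Two points catch the roots whatever the degree. For a negative discriminant [Num.sqrt] takes a
    default value, but then no real [y] is a root. *)
Lemma quadratic_roots (a b c : R) : ~ (a = 0 /\ b = 0 /\ c = 0) ->
  exists y1 y2, forall y, a * y ^+ 2 + b * y + c = 0 -> y = y1 \/ y = y2.
Proof.
move=> abc; have [a0|a0] := eqVneq a 0.
  have [b0|b0] := eqVneq b 0.
    exists 0, 0 => y; rewrite a0 b0 !mul0r !add0r => c0; exfalso; exact: abc.
  exists (- c / b), (- c / b) => y; rewrite a0 mul0r add0r => h; left.
  by apply: (mulfI b0); rewrite mulrCA mulfV// mulr1; apply/eqP; rewrite -addr_eq0 h.
pose d := b ^+ 2 - 4 * a * c.
exists ((- b + Num.sqrt d) / (2 * a)), ((- b - Num.sqrt d) / (2 * a)) => y h.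
have a2 : 2 * a != 0 by rewrite mulf_neq0.
have hd : (2 * a * y + b) ^+ 2 = d.
  have -> : (2 * a * y + b) ^+ 2 = 4 * a * (a * y ^+ 2 + b * y + c) + d by rewrite /d; ring.
  by rewrite h mulr0 add0r.
have d0 : 0 <= d by rewrite -hd sqr_ge0.
have : (2 * a * y + b) ^+ 2 == Num.sqrt d ^+ 2 by rewrite hd sqr_sqrtr.
rewrite eqf_sqr => /orP[/eqP e|/eqP e]; [left|right].
  by rewrite -e; field.
by rewrite -e; field.
Qed.

Lemma lebesgue_set2 (y1 y2 : R) : leb [set y1; y2] = 0%E.
Proof. by apply: countable_lebesgue_measure0; exact: finite_set_countable. Qed.

Definition quad (al be ga : R) (x : plane R) :=
  al * x.1 ^+ 2 + be * (x.1 * x.2) + ga * x.2 ^+ 2.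

Lemma measurable_quad al be ga : measurable_fun setT (quad al be ga).
Proof.
have m1 : measurable_fun setT (fun x : plane R => x.1 : R) by exact: measurable_fst.
have m2 : measurable_fun setT (fun x : plane R => x.2 : R) by exact: measurable_snd.
apply: measurable_funD; first apply: measurable_funD; apply: measurable_funM => //.
- exact: measurable_funX.
- exact: measurable_funM.
- exact: measurable_funX.
Qed.

(** By Tonelli it is enough that almost every vertical slice is null, and a slice is the zero set of
    a polynomial of degree at most 2. *)
Lemma quad_level_negligible al be ga (c : R) : ~ (al = 0 /\ be = 0 /\ ga = 0) ->
  (leb2 R).-negligible [set x | quad al be ga x = c].
Proof.
move=> abg; pose Z := [set x : plane R | quad al be ga x = c].
have mZ : measurable Z.
  rewrite (_ : Z = quad al be ga @^-1` [set c])// -[X in measurable X]setTI.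
  exact: measurable_quad.
suff Z0 : leb2 R Z = 0%E by apply/negligibleP.
rewrite -(setIT Z) -integral_indic//.
have mI : measurable_fun setT (fun x => (\1_Z x)%:E : \bar R).
  by apply/measurable_EFinP; exact: measurable_indic.
have I0 x : (0 <= (\1_Z x)%:E :> \bar R)%E by rewrite lee_fin.
rewrite leb2_tonelli//.
(* Abscissas at which the slice polynomial vanishes identically; there are at most two, as the form
   is nonzero. *)
pose bad := [set x : R | [/\ ga = 0, be * x = 0 & al * x ^+ 2 - c = 0]].
have [y1 [y2 hbad]] : exists y1 y2, bad `<=` [set y1; y2].
  have [g0|g0] := eqVneq ga 0; last first.
    by exists 0, 0 => x [/eqP]; rewrite (negbTE g0).
  have [b0|b0] := eqVneq be 0; last first.
    exists 0, 0 => x [_ /eqP + _]; rewrite mulf_eq0 (negbTE b0)/= => /eqP ->.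
    by left.
  have [|y1 [y2 hy]] := @quadratic_roots al 0 (- c).
    by move=> [a0 _]; apply: abg.
  exists y1, y2 => x [_ _ h]; apply: hy; rewrite mul0r addr0.
  exact: h.
rewrite -(integral0 leb setT).
apply: ge0_ae_eq_integral => //.
- exact: (@measurable_fun_fubini_tonelli_F _ _ _ _ _ leb (fun x => (\1_Z x)%:E)).
- by move=> x _; apply: integral_ge0.
have n12 : leb.-negligible [set y1; y2].
  by apply/negligibleP; [exact: measurableU|exact: lebesgue_set2].
apply: negligibleS n12 => x /= nx; apply: hbad; apply: contrapT => nb; apply: nx => _.
have [|z1 [z2 hz]] := @quadratic_roots ga (be * x) (al * x ^+ 2 - c).
  by move=> [? [? ?]]; apply: nb.
have mx : measurable [set y : RR | Z (x, y)].
  have := measurable_xsection x mZ; congr (measurable _).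
  by apply/funext => y; rewrite /xsection/= inE.
rewrite (_ : (\int[leb]_y _)%E = (\int[leb]_y (\1_[set y : RR | Z (x, y)] y)%:E)%E).
  rewrite integral_indic// setIT; apply: (@subset_measure0 _ _ _ leb _ [set z1; z2]) => //.
  - exact: measurableU.
  - move=> y; rewrite /Z /quad/= => h; apply: hz; rewrite -h; ring.
  - exact: lebesgue_set2.
by apply: eq_integral => y _; rewrite !indicE; congr (_%:R)%:E; apply/idP/idP; rewrite !inE.
Qed.

End quadratic_level_sets.

(** * A quadratic form scaled by the flow *)

Section covariant_quadratic_form.
Context {R : realType}.
Implicit Types (X a : 'M[R]_2) (x y : plane R).

Definition wedge x y : R := x.1 * y.2 - x.2 * y.1.

Lemma wedge_act a x y : wedge (act a x) (act a y) = \det a * wedge x y.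
Proof. by rewrite /wedge !actE det2E/=; ring. Qed.

Lemma wedge_quad X x :
  wedge x (act X x) =
  quad (X ord0 ord_max) (X ord_max ord_max - X ord0 ord0) (- X ord_max ord0) x.
Proof. by rewrite /wedge /quad actE/=; ring. Qed.

(* For X not scalar the form is the determinant of (x, X^T x), which commutation
   of X with its exponential makes covariant. *)
Lemma quad_covariant X : exists al be ga,
  ~ (al = 0 /\ be = 0 /\ ga = 0) /\
  forall t x, quad al be ga (act (expmx (t *: X)) x) =
              expR (\tr X * t) * quad al be ga x.
Proof.
pose al := X ord0 ord_max; pose be := X ord_max ord_max - X ord0 ord0.
pose ga := - X ord_max ord0.
have [[al0 [be0 ga0]]|nz] := pselect (al = 0 /\ be = 0 /\ ga = 0); last first.
  exists al, be, ga; split => // t x.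
  by rewrite -!wedge_quad -actM -expmx_comm actM wedge_act det_expmx.
(* Here [X] is scalar and the wedge form vanishes. The square of the first coordinate serves
   instead: it is scaled by [expR (l * t) ^+ 2], and [\tr X] is twice [l]. *)
have X10 : X ord_max ord0 = 0 by apply/eqP; rewrite -oppr_eq0; apply/eqP.
have X01 : X ord0 ord_max = 0 by [].
have X11 : X ord_max ord_max = X ord0 ord0 by apply/eqP; rewrite -subr_eq0; apply/eqP.
exists 1, 0, 0; split => [[/eqP]|t x]; first by rewrite oner_eq0.
pose l := X ord0 ord0.
have E00 : expmx (t *: X) ord0 ord0 = expR (l * t).
  have d s : is_derive (s : R) (1 : R) (fun t => expmx (t *: X) ord0 ord0)
      (l * expmx (s *: X) ord0 ord0).
    by apply: is_derive_eq (is_derive_expmx X ord0 ord0 s) _; rewrite mxE2 X01 mul0r addr0.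
  by rewrite (derive_expR_eq d) expmx0 mxE/= mulr1.
have E10 : expmx (t *: X) ord_max ord0 = 0.
  have d s : is_derive (s : R) (1 : R) (fun t => expmx (t *: X) ord_max ord0)
      (l * expmx (s *: X) ord_max ord0).
    by apply: is_derive_eq (is_derive_expmx X ord_max ord0 s) _; rewrite mxE2 X10 mul0r add0r X11.
  by rewrite (derive_expR_eq d) expmx0 mxE/= mulr0.
rewrite /quad actE/= E00 E10 tr2E X11 -/l.
have -> : expR ((l + l) * t) = expR (l * t) ^+ 2 by rewrite mulrDl expRD expr2.
ring.
Qed.

End covariant_quadratic_form.

(** * A section of finite area *)

Section section_set.
Context {R : realType}.
Implicit Types (X a : 'M[R]_2).
Local Notation leb := (@lebesgue_measure R).
Local Notation RR := (measurableTypeR R).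

Lemma leb2_preimage_act a (A : set (plane R)) : \det a != 0 -> measurable A ->
  leb2 R (act a @^-1` A) = ((`|\det a|^-1)%:E * leb2 R A)%E.
Proof.
move=> a0 mA; have [mphi int_phi] := scales_area_act a0.
have mP : measurable (act a @^-1` A).
  by rewrite -[X in measurable X]setTI; exact: mphi.
have -> : leb2 R (act a @^-1` A) = (\int[leb2 R]_x (\1_A (act a x))%:E)%E.
  by rewrite -(setIT (act a @^-1` A)) -integral_indic.
have -> : leb2 R A = (\int[leb2 R]_x (\1_A x)%:E)%E by rewrite integral_indic// setIT.
apply: (int_phi (fun x => (\1_A x)%:E)).
- by apply/measurable_EFinP; exact: measurable_indic.
- by move=> x; rewrite lee_fin.
Qed.

Lemma leb2_box (m : R) : 0 <= m ->
  leb2 R (`[- m, m]%classic `*` `[- m, m]%classic) = (4 * m ^+ 2)%:E.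
Proof.
move=> m0; pose I := [set` `[- m, m]] : set RR.
transitivity (leb I * leb I)%E; first by apply: product_measure1E.
have -> : leb I = (2 * m)%:E :> \bar R.
  rewrite lebesgue_measure_itv/= lte_fin.
  case: ltP => [_|h]; first by rewrite -EFinB; congr _%:E; ring.
  by congr _%:E; lra.
by rewrite -EFinM; congr _%:E; ring.
Qed.

(** [quad 1 0 1] is the squared Euclidean norm. [e] will be [expR (\tr X)], the factor that the form
    gains in unit time. *)
Definition shell (e al be ga : R) (j : nat) : set (plane R) :=
  (fun x => `|quad al be ga x|) @^-1` `[1, e[ `&`
  quad 1 0 1 @^-1` `[j%:R, j.+1%:R[.

Definition open_shell (e al be ga : R) (j : nat) : set (plane R) :=
  (fun x => `|quad al be ga x|) @^-1` `]1, e[ `&`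
  quad 1 0 1 @^-1` `]j%:R, j.+1%:R[.

Lemma measurable_shell e al be ga j : measurable (shell e al be ga j).
Proof.
apply: measurableI; rewrite -[X in measurable X]setTI.
- by apply: measurableT_comp => //; exact: measurable_quad.
- exact: measurable_quad.
Qed.

(** The squared norm is below [j.+1 <= j.+1 ^+ 2], so a square of half-side [j.+1] contains the
    shell. Any polynomial bound would serve against exponential decay. *)
Lemma leb2_shell e al be ga j :
  (leb2 R (shell e al be ga j) <= (4 * j.+1%:R ^+ 2)%:E)%E.
Proof.
rewrite -leb2_box//; apply: le_measure; rewrite ?inE.
- exact: measurable_shell.
- exact: measurableX.
move=> x [_]; rewrite /= in_itv/= /quad mul1r mul0r addr0 mul1r => /andP[_ r].
have j1 : 1 <= j.+1%:R :> R by rewrite ler1n.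
have b (u v : R) : u ^+ 2 + v ^+ 2 < j.+1%:R -> u \in `[- j.+1%:R, j.+1%:R].
  move=> h; rewrite in_itv/= -ler_norml -(@ler_pXn2r _ 2)// ?nnegrE//.
  rewrite real_normK ?num_real//; have := sqr_ge0 v; nra.
by split => /=; apply: b; [exact: r|rewrite addrC; exact: r].
Qed.

(** The upper bounds of a shell are already strict, so only its two lower bounds can be attained. *)
Lemma open_shellP e al be ga j x : shell e al be ga j x -> ~ open_shell e al be ga j x ->
  quad al be ga x = 1 \/ quad al be ga x = - 1 \/ quad 1 0 1 x = j%:R.
Proof.
move=> [/=]; rewrite !in_itv/= => /andP[q1 q2] /andP[r1 r2] nO.
have [r0|r0] := eqVneq (quad 1 0 1 x) j%:R; first by right; right.
have [q0|q0] := eqVneq `|quad al be ga x| 1.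
  by case: (ger0P (quad al be ga x)) q0 => _ q0; [left|right; left; rewrite -q0 opprK].
by exfalso; apply: nO; split; rewrite /= in_itv/= lt_neqAle 1?eq_sym ?q0 ?r0 ?q1 ?r1.
Qed.

Lemma continuous_quad_act a al be ga :
  continuous (fun x : R * R => quad al be ga (act a x)).
Proof.
move=> x; rewrite /quad /act /mxact/=.
have c1 : (fun y : R * R => y.1) @ x --> x.1 by exact: cvg_fst.
have c2 : (fun y : R * R => y.2) @ x --> x.2 by exact: cvg_snd.
have c i j : (fun y : R * R => a^T i ord0 * y.1 + a^T i ord_max * y.2) @ x -->
    a^T i ord0 * x.1 + a^T i ord_max * x.2.
  by apply: cvgD; apply: cvgM => //; exact: cvg_cst.
apply: cvgD; first apply: cvgD; apply: cvgM; try exact: cvg_cst.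
- by apply: cvgM; exact: c.
- by apply: cvgM; exact: c.
- by apply: cvgM; exact: c.
Qed.

Lemma open_shell_nbhs e al be ga j a z : open_shell e al be ga j (act a z) ->
  exists2 d : R, 0 < d & forall y : R * R, `|y.1 - z.1| <= d ->
    `|y.2 - z.2| <= d -> open_shell e al be ga j (act a y).
Proof.
pose f1 (x : R * R) := `|quad al be ga (act a x)|.
pose f2 (x : R * R) := quad 1 0 1 (act a x).
have oO : open (f1 @^-1` `]1, e[ `&` f2 @^-1` `]j%:R, j.+1%:R[).
  apply: openI; apply: open_comp; try exact: interval_open.
  - move=> x _; apply: (continuous_comp (@continuous_quad_act _ _ _ _ x)).
    exact: norm_continuous.
  - by move=> x _; exact: continuous_quad_act.
move=> Oz; have /nbhs_ballP[d /= d0 hd] := open_nbhs_nbhs (conj oO Oz).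
(* Halving passes from an open ball to the closed box that [fourier_L2_indicator] expects. *)
exists (d / 2); first by rewrite divr_gt0.
move=> y h1 h2; apply: hd; split; rewrite -ball_normE /ball_/=.
- by rewrite distrC (le_lt_trans h1)// ltr_pdivrMr// ltr_pMr// ltr1n.
- by rewrite distrC (le_lt_trans h2)// ltr_pdivrMr// ltr_pMr// ltr1n.
Qed.

End section_set.

(** * The flow section: area, boundary and hitting measure *)

Section wavelet_section.
Context {R : realType}.
Variables (X : 'M[R]_2) (mu : {measure set (borel_mx R) -> \bar R}).
Hypothesis hmu : left_haar (one_param_group X) mu.
Local Notation BM := (borel_mx R).
Let tau := \tr X.
Hypothesis tau0 : 0 < tau.
Variables al be ga : R.
Hypothesis nz : ~ (al = 0 /\ be = 0 /\ ga = 0).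
Local Notation Q := (quad al be ga).
Local Notation E t := (expmx (t *: X)).
Hypothesis covQ : forall t x, Q (act (E t) x) = expR (tau * t) * Q x.

Let A j := shell (expR tau) al be ga j.
Let S_ (j : nat) := act (E j%:R) @^-1` A j.
Definition flow_section := \bigcup_j S_ j.
Local Notation S := flow_section.

Let detE t : \det (E t) = expR (tau * t).
Proof. exact: det_expmx. Qed.

Let detE0 t : \det (E t) != 0.
Proof. by rewrite detE gt_eqF// expR_gt0. Qed.

Let measurable_act a (B : set (plane R)) : \det a != 0 -> measurable B ->
  measurable (act a @^-1` B).
Proof.
move=> a0 mB; rewrite -[X in measurable X]setTI.
by have [mphi _] := scales_area_act a0; exact: mphi.
Qed.

Let measurable_S_ j : measurable (S_ j).
Proof. by apply: measurable_act => //; exact: measurable_shell. Qed.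

Lemma measurable_flow_section : measurable S.
Proof. exact: bigcup_measurable. Qed.

Let C := 4 * (1 + 4 / tau) ^+ 2.

Let leb2_S_ j : (leb2 R (S_ j) <= (geometric C (expR (- tau / 2)) j)%:E)%E.
Proof.
rewrite leb2_preimage_act//; last exact: measurable_shell.
rewrite detE ger0_norm ?expR_ge0// -expRN.
apply: (@le_trans _ _ ((expR (- (tau * j%:R)))%:E * (4 * j.+1%:R ^+ 2)%:E)%E).
  by rewrite lee_pmul2l// ?lte_fin ?expR_gt0//; exact: leb2_shell.
rewrite -EFinM lee_fin /geometric/=.
(* Each of the two factors [j.+1] costs a rate [tau / 4], which leaves [tau / 2] of the decay rate
   [tau]. The constant [1 + 4 / tau] comes from [1 + k * j <= expR (k * j)]. *)
set k := tau / 4; have k0 : 0 < k by rewrite divr_gt0.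
have h1 : j.+1%:R <= (1 + 4 / tau) * expR (k * j%:R).
  apply: (@le_trans _ _ ((1 + 4 / tau) * (1 + k * j%:R))).
    have c0 : 0 < 4 / tau by rewrite divr_gt0.
    have -> : (1 + 4 / tau) * (1 + k * j%:R) = 1 + k * j%:R + 4 / tau + j%:R.
      by rewrite /k; field; rewrite gt_eqF.
    have : 0 <= k * j%:R by rewrite mulr_ge0 ?(ltW k0).
    rewrite -natr1; lra.
  by rewrite ler_pM2l ?expR_ge1Dx// addr_gt0 ?divr_gt0.
have h2 : j.+1%:R ^+ 2 <= ((1 + 4 / tau) * expR (k * j%:R)) ^+ 2.
  by rewrite ler_pXn2r// nnegrE ?ler0n//; apply: le_trans h1.
have -> : C * expR (- tau / 2) ^+ j =
    expR (- (tau * j%:R)) * (4 * ((1 + 4 / tau) * expR (k * j%:R)) ^+ 2).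
  rewrite -expRM_natl exprMn -expRM_natl /C.
  have -> : expR (j%:R * (- tau / 2)) = expR (- (tau * j%:R)) * expR (2%:R * (k * j%:R)).
    by rewrite -expRD; congr expR; rewrite /k; field.
  ring.
by rewrite ler_pM2l ?expR_gt0// ler_pM2l.
Qed.

Lemma flow_section_fin : (leb2 R S < +oo)%E.
Proof.
have q1 : `|expR (- tau / 2)| < 1.
  by rewrite ger0_norm ?expR_ge0// expR_lt1 mulNr oppr_lt0 divr_gt0.
apply: (@le_lt_trans _ _ (C / (1 - expR (- tau / 2)))%:E); last exact: ltry.
apply: (@le_trans _ _ (\sum_(j <oo) leb2 R (S_ j))%E).
  by apply: measure_sigma_subadditive => //; exact: measurable_flow_section.
apply: (@le_trans _ _ (\sum_(j <oo) (geometric C (expR (- tau / 2)) j)%:E)%E).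
  by apply: lee_nneseries.
have C0 : 0 <= C by rewrite mulr_ge0// sqr_ge0.
set q := expR _ in q1 *; have q0 : 0 <= q by exact: expR_ge0.
rewrite ger0_norm// in q1.
apply: lime_le.
  by apply: is_cvg_nneseries => n _ _; rewrite lee_fin /geometric/= mulr_ge0// exprn_ge0.
apply: nearW => n; rewrite sumEFin lee_fin.
have := @geometric_seriesE _ C q (negbT (lt_eqF q1)).
move=> /(congr1 (fun f => f n)); rewrite /series/= => ->.
by rewrite ler_pM2r ?invr_gt0 ?subr_gt0// ler_piMr// gerBl exprn_ge0.
Qed.

(** Interior points are taken piece by piece. What is left lies in countably many preimages of level
    sets, null because invertible linear maps scale area. *)
Lemma flow_section_null :
  exists2 O : set (plane R), (leb2 R).-negligible (S `\` O) &
  forall z, O z -> exists2 d : R, 0 < d & forall y : R * R,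
    `|y.1 - z.1| <= d -> `|y.2 - z.2| <= d -> S y.
Proof.
pose Oj j := open_shell (expR tau) al be ga j.
exists (\bigcup_j (act (E j%:R) @^-1` Oj j)); last first.
  move=> z [j _ Oz]; have [d d0 hd] := open_shell_nbhs Oz.
  exists d => // y h1 h2; exists j => //.
  have [+ +] := hd y h1 h2; rewrite /= !in_itv/= => /andP[q1 q2] /andP[r1 r2].
  by split; rewrite /= in_itv/= ?(ltW q1) ?(ltW r1) ?q2 ?r2.
have nullB j (B : set (plane R)) : measurable B -> (leb2 R).-negligible B ->
    (leb2 R).-negligible (act (E j%:R) @^-1` B).
  move=> mB /negligibleP -/(_ mB) B0.
  apply/negligibleP; first exact: measurable_act.
  by have := leb2_preimage_act (detE0 j%:R) mB; rewrite B0 mule0.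
have mq a b c v : measurable [set x : plane R | quad a b c x = v].
  rewrite (_ : [set x | _] = quad a b c @^-1` [set v])// -[X in measurable X]setTI.
  exact: measurable_quad.
pose N j := act (E j%:R) @^-1` [set x | Q x = 1] `|`
  (act (E j%:R) @^-1` [set x | Q x = -1] `|`
   act (E j%:R) @^-1` [set x | quad 1 0 1 x = j%:R]).
have nN : (leb2 R).-negligible (\bigcup_j N j).
  apply: negligible_bigcup => j; apply: negligibleU; last apply: negligibleU.
  - by apply: nullB => //; exact: quad_level_negligible.
  - by apply: nullB => //; exact: quad_level_negligible.
  - apply: nullB => //; apply: quad_level_negligible => -[/eqP].
    by rewrite oner_eq0.
apply: negligibleS nN.
move=> x [[j _ Sx] nO]; exists j => //.
have [|h|[h|h]] := open_shellP Sx.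
- by move=> Ox; apply: nO; exists j.
- by left.
- by right; left.
- by right; right.
Qed.

Let measurable_hits x (B : set (plane R)) : measurable B ->
  measurable [set a : BM | B (act a x)].
Proof.
move=> mB; have := @measurable_mxact_tr R _ BM id (fun=> x) (@measurable_id _ _ _).
move=> /(_ (measurable_cst _)) h.
have := h measurableT B mB; rewrite setTI; exact.
Qed.

(** Pulled back, the pieces occupy successive bands of [|Q|]; the shells themselves share one band
    and are separated by the norm. *)
Let S_disjoint : trivIset setT S_.
Proof.
have h i j x : S_ i x -> S_ j x -> (j <= i)%N.
  move=> [/= Si _] [/= Sj _]; move: Si Sj.
  rewrite !in_itv/= !covQ !normrM !(gtr0_norm (expR_gt0 _)).
  move=> /andP[Si _] /andP[_ Sj].
  have : expR (tau * j%:R) * `|Q x| < expR (tau * i.+1%:R) * `|Q x|.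
    rewrite (lt_le_trans Sj)// -natr1 mulrDr mulr1 addrC expRD -mulrA.
    by rewrite ler_peMr ?expR_ge0.
  have Qx : 0 < `|Q x|.
    rewrite lt_neqAle normr_ge0 andbT; apply/eqP => Qx0.
    by move: Si; rewrite -Qx0 mulr0 ler10.
  by rewrite ltr_pM2r// ltr_expR ltr_pM2l// ltr_nat ltnS.
move=> i j _ _ [x [Si Sj]]; apply/eqP; rewrite eqn_leq.
by rewrite (h _ _ _ Si Sj) (h _ _ _ Sj Si).
Qed.

Let A_disjoint : trivIset setT A.
Proof.
have h i j x : A i x -> A j x -> (i <= j)%N.
  move=> [_ /= +] [_ /= +]; rewrite !in_itv/= => /andP[ri _] /andP[_ rj].
  by rewrite -ltnS -(ltr_nat R) (le_lt_trans ri).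
move=> i j _ _ [x [Ai Aj]]; apply/eqP; rewrite eqn_leq.
by rewrite (h _ _ _ Ai Aj) (h _ _ _ Aj Ai).
Qed.

Lemma haar_flow_section x : Q x != 0 ->
  mu [set a : BM | S (act a x)] = mu (time_set X `[0, 1[).
Proof.
move=> Qx; pose hits B : set BM := [set a : BM | B (act a x)].
have hits_disjoint (B : (set (plane R))^nat) : trivIset setT B ->
    trivIset setT (fun j => hits (B j)).
  by move=> tB i j _ _ [a [Bi Bj]]; apply: tB => //; exists (act a x).
have mA j : measurable (A j) by exact: measurable_shell.
transitivity (mu (\bigcup_j hits (S_ j))).
  by congr (mu _); apply/seteqP; split => a [j _ h]; exists j.
rewrite measure_bigcup; last 2 first.
- by move=> j _; exact: measurable_hits.
- exact: hits_disjoint.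
transitivity (\sum_(j <oo | j \in setT) mu (hits (A j)))%E.
  apply: eq_eseriesr => j _.
  (* By commutativity [a] sends [x] into [S_ j] exactly when [E j%:R *m a] sends it into [A j], so
     invariance equates the measures term by term. *)
  rewrite -(haar_preimage_translate hmu j%:R); last exact: measurable_hits.
  rewrite [LHS](haar_setI hmu); last exact: measurable_hits.
  rewrite [RHS](haar_setI hmu); last first.
    by rewrite -[X in measurable X]setTI; apply: measurable_mulmx => //; exact: measurable_hits.
  congr (mu _); apply/seteqP; split => a [+ [t _ Et]]; rewrite /hits /S_/= -Et -actM.
  - by rewrite -!expmxD addrC => h; split; [|exact: mem_one_param].
  - by rewrite -!expmxD addrC => h; split; [|exact: mem_one_param].
rewrite -measure_bigcup; last 2 first.
- by move=> j _; exact: measurable_hits.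
- exact: hits_disjoint.
have mU : measurable (\bigcup_j hits (A j)).
  by apply: bigcupT_measurable => j; exact: measurable_hits.
rewrite (haar_setI hmu mU).
(* The time at which the orbit of [x] enters the band, that is, at which [|Q|] equals 1. *)
pose t0 := - (ln `|Q x| / tau).
rewrite -(haar_time_set_co hmu t0); congr (mu _).
have Qt t : (`|Q (act (E t) x)| \in `[1, expR tau[) = (t \in `[t0, t0 + 1[).
  have Q0 : 0 < `|Q x| by rewrite normr_gt0.
  rewrite covQ normrM gtr0_norm ?expR_gt0// -{1}(lnK Q0) -expRD !in_itv/=.
  rewrite -expR0 ler_expR ltr_expR.
  have -> : ln `|Q x| = - (t0 * tau) by rewrite /t0 mulNr opprK divfK// gt_eqF.
  have -> : tau * t + - (t0 * tau) = tau * (t - t0) by ring.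
  by rewrite pmulr_rge0// subr_ge0 gtr_pMr// ltrBlDl expR0.
apply/seteqP; split => [a [[j _ [/= qa ra]] [t _ Et]]|a [t It Et]].
  by exists t => //=; rewrite -Qt Et.
split; last by exists t.
(* Shells are numbered by the integer part of the squared norm. *)
exists (Num.truncn (quad 1 0 1 (act a x))) => //; split => /=.
  by rewrite -Et Qt.
rewrite in_itv/= truncn_itv//.
by rewrite /quad mul1r mul0r addr0 mul1r addr_ge0 ?sqr_ge0.
Qed.

End wavelet_section.

(** * Admissibility *)

Section both_directions.
Context {R : realType} (X : 'M[R]_2) (mu : {measure set (borel_mx R) -> \bar R}).
Hypothesis hmu : left_haar (one_param_group X) mu.
Local Notation BM := (borel_mx R).

Let hit_measurable (h : plane R -> \bar R) x : measurable_fun setT h ->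
  measurable_fun setT (fun a : BM => h (act a x)).
Proof.
move=> mh; apply: (measurableT_comp mh).
exact: (@measurable_mxact_tr R _ BM id (fun=> x)).
Qed.

Lemma admissible_of_tr_gt0 : 0 < \tr X -> admissible (one_param_group X) mu.
Proof.
move=> tr0; have [al [be [ga [nz cov]]]] := quad_covariant X.
pose S := flow_section X al be ga.
have mS : measurable S by exact: measurable_flow_section.
have finS : (leb2 R S < +oo)%E by exact: flow_section_fin.
have [U nullSU intU] := flow_section_null X nz.
pose T := time_set X `[0, 1[.
have c0 : 0 < fine (mu T).
  by rewrite fine_gt0// haar_unit_gt0//= haar_unit_fin.
pose c := Num.sqrt (fine (mu T))^-1.
have [psi hpsi] := fourier_L2_indicator mS finS nullSU intU c.
exists psi, (fun z => c * \1_S z +i* 0); split => //; first by case: hpsi.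
(* The exceptional points are the zeros of the form, whose orbits never meet the section. *)
have nQ := quad_level_negligible 0 nz.
apply: negligibleS nQ => x /= nx; apply: contrapT => /eqP Qx; apply: nx => _.
have mI : measurable_fun setT (fun x : plane R => (\1_S x)%:E : \bar R).
  by apply/measurable_EFinP; exact: measurable_indic.
have mH : measurable [set a : BM | S (act a x)].
  have := @measurable_mxact_tr R _ BM id (fun=> x) (@measurable_id _ _ _) (measurable_cst _).
  by move=> /(_ measurableT _ mS); rewrite setTI.
rewrite /Delta.
have psiE (a : BM) : ((cnorm ((c * \1_S (act a x)) +i* 0) ^+ 2)%:E =
    (c ^+ 2)%:E * (\1_[set a : BM | S (act a x)] a)%:E)%E.
  rewrite cnorm_sqr expr0n/= addr0 exprMn -EFinM; congr ((_ * _)%:E).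
  rewrite !indicE (_ : (act a x \in S) = (a \in [set a : BM | S (act a x)])).
    by case: (_ \in _); rewrite ?expr1n ?expr0n.
  by apply/idP/idP; rewrite !inE.
under eq_integral do rewrite -[mxact _ _]/(act _ x) psiE.
rewrite (haar_integral_restrict hmu); last 2 first.
- apply: measurable_funeM; apply/measurable_EFinP; exact: measurable_indic.
- by move=> a; rewrite -EFinM lee_fin mulr_ge0// sqr_ge0.
rewrite ge0_integralZl//; last 2 first.
- by apply/measurable_EFinP; exact: measurable_indic.
- by rewrite lee_fin sqr_ge0.
rewrite integral_indic// setIT (haar_flow_section hmu tr0 cov)//.
rewrite -[X in (_ * X)%E]fineK; last by rewrite ge0_fin_numE// haar_unit_fin.
by rewrite -EFinM sqr_sqrtr ?invr_ge0 ?(ltW c0)// mulVf// gt_eqF.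
Qed.

Lemma tr_neq0_of_admissible : admissible (one_param_group X) mu -> \tr X != 0.
Proof.
move=> [psi [psihat [_ [_ [[mRe mIm] finh] _] aeD]]]; apply/eqP => tr0.
pose h x := ((cnorm (psihat x) ^+ 2)%:E : \bar R).
have mh : measurable_fun setT h.
  apply/measurable_EFinP.
  rewrite (_ : (fun x => _) = (fun x => complex.Re (psihat x) ^+ 2 + complex.Im (psihat x) ^+ 2)).
    by apply: measurable_funD; exact: measurable_funX.
  by apply/funext => x; case: (psihat x) => a b; rewrite cnorm_sqr.
have h0 x : (0 <= h x)%E by rewrite lee_fin sqr_ge0.
apply: (unimodular_no_section hmu tr0 mh h0 finh).
(* The origin, left out of the admissibility condition, is null as the zero set of the squared
   norm. *)
have n0 : (leb2 R).-negligible [set x : plane R | quad 1 0 1 x = 0].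
  by apply: quad_level_negligible => -[/eqP]; rewrite oner_eq0.
apply: negligibleS (negligibleU n0 aeD) => x /= nx.
have [->|x0] := pselect (x = (0, 0)).
  by left; rewrite /quad/= expr0n/= !mulr0 !addr0.
right => hx; apply: nx; rewrite -hx; last exact/eqP.
rewrite /Delta (haar_integral_restrict hmu)//.
- exact: (hit_measurable x mh).
- by move=> a; exact: h0.
Qed.

End both_directions.

Lemma one_param_groupN (R : realType) (X : 'M[R]_2) :
  one_param_group (- X) = one_param_group X.
Proof.
apply/seteqP; split => _ [t _ <-]; exists (- t) => //.
  by rewrite scaleNr -scalerN.
by rewrite scaleNr scalerN opprK.
Qed.

Theorem theorem3p3 (R : realType) (X : 'M[R]_2)
    (mu : {measure set (borel_mx R) -> \bar R})
    (hmu : left_haar (one_param_group X) mu) :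
  admissible (one_param_group X) mu <-> \tr X != 0.
Proof.
split; first exact: tr_neq0_of_admissible.
rewrite neq_lt => /orP[tr0|]; last exact: admissible_of_tr_gt0.
rewrite -one_param_groupN; apply: admissible_of_tr_gt0.
  by rewrite one_param_groupN.
by rewrite raddfN oppr_gt0.
Qed.
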